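(* Let $q$ be a prime power and $m\ge 1$ an integer with $\gcd(m,q-1)=1$. Then $\mathbb{F}_{q^m}$ contains an element $\alpha$ that is normal over $\mathbb{F}_q$ (i.e. $\{\alpha,\alpha^q,\ldots,\alpha^{q^{m-1}}\}$ is a basis of $\mathbb{F}_{q^m}$ over $\mathbb{F}_q$) and whose multiplicative order in $\mathbb{F}_{q^m}^*$ equals $\frac{q^m-1}{q-1}$. *)

(* Defs.v *)
From HB Require Import structures.
From mathcomp Require Import all_boot all_order all_fingroup all_algebra all_solvable all_field.

Set Implicit Arguments.
Unset Strict Implicit.
Unset Printing Implicit Defensive.

Definition normal_over (F : finFieldType) (L : fieldExtType F) (a : L) : bool :=
  basis_of {:L}%VS [seq (a ^+ (#|F| ^ i))%R | i <- iota 0 (\dim {:L}%VS)].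

(* Main.v *)
Require Import Defs.
From mathcomp Require Import all_boot all_order all_fingroup all_algebra all_solvable all_field.
From mathcomp Require Import zify.
From Stdlib Require BinNat Nnat.

(**
Write q for the order of F, K for the extension, n = q^m - 1 and
N = n / (q - 1); the hypothesis makes N and q - 1 coprime. If x is normal and
is not an l-th power for any prime l dividing N, then a scalar multiple of x has
order N, and it is still normal. The number of such x is estimated by expanding
two indicator functions: that of the non-l-th powers in multiplicative
characters, and that of the normal elements (those outside the kernels of
((X^m - 1) / f)(Frobenius), f running over the irreducible factors of X^m - 1) in the
averages of additive characters over the lines of scalars. Up to common factors
these expansions have l1-norms 2^w and 2^r, where w and r count the primes and the
factors, and nontrivial characters interact through Gauss sums of modulus at
most q^(m/2). So an x exists as soon as (2^w - 1) (2^r - 1) < q^(m/2). Since X - 1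
is the only linear factor of X^m - 1, this inequality holds except for q = 2 and
m = 3, 6, 15; in these cases only some of the primes are put in the expansion,
the powers for the other primes being discarded by their mere number.
*)

Set Implicit Arguments.
Unset Strict Implicit.
Unset Printing Implicit Defensive.
Import Order.TTheory GRing.Theory Num.Theory.
Local Open Scope ring_scope.

(** * Functions with a finite spectrum *)

(** Each condition costs a factor 2 whatever its size: when the complement of the annihilator of a
    finite group U of characters is expanded, the trivial character has coefficient 1 - 1/|U|, and
    the others have the same total in absolute value. Different conditions use independent groups
    (coprime orders, coprime polynomials), so the trivial coefficients multiply without interference
    and form the common factors; only pairs of characters nontrivial on both sides enter the error
    term, whence 2^w - 1 and 2^r - 1. Kernels of polynomials in the Frobenius map are stable under
    scalars, so averaging additive characters over lines loses nothing. The averages only see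
    whether a trace vanishes, hence are rational and need no additive character to be built. The
    price is that a product of two averages is itself an average, which explains the parameter [z]
    in [eM]. In the final inequality, w is controlled by the size of N and r by about m / 2; the
    latter is too weak for q = 2 and q = 3, where factors of small degree must be counted
    separately. *)

Section Spectral.

Variables (C : numFieldType) (I X Z : finType).
Variables (e : I -> X -> C) (op : Z -> I -> I -> I) (i0 : I).
Hypothesis Z_gt0 : (0 < #|Z|)%N.
Hypothesis eM : forall i j x,
  e i x * e j x = #|Z|%:R^-1 * \sum_z e (op z i j) x.

(* [v] is a combination of the [e i], [i] in [S], whose coefficients have
   l1-norm at most [beta]; [mu] is the coefficient of the trivial character. *)
Definition spectral (S : {pred I}) (v : X -> C) (mu beta : C) :=
  exists c : I -> C, [/\ forall x, v x = \sum_i c i * e i x, c i0 = mu,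
    forall i, i \notin S -> c i = 0 & \sum_i `|c i| <= beta].

(** The last hypothesis is independence: a product of characters from [S] and [S'] is trivial only
    if both are, so nothing else reaches the trivial coefficient. The l1-norm is submultiplicative
    because a product of characters is an average of characters. *)
Lemma spectralM (S S' S'' : {pred I}) v v' mu mu' beta beta' :
    spectral S v mu beta -> spectral S' v' mu' beta' ->
    (forall z i j, i \in S -> j \in S' -> op z i j \in S'') ->
    (forall z i j, i \in S -> j \in S' ->
       (op z i j == i0) = (i == i0) && (j == i0)) ->
  spectral S'' (fun x => v x * v' x) (mu * mu') (beta * beta').
Proof.
move=> [c [vE <- cS cB]] [c' [v'E <- c'S c'B]] opS op0.
have Zn0 : #|Z|%:R != 0 :> C by rewrite pnatr_eq0 -lt0n.
pose a z i j k := ((op z i j == k)%:R * (c i * c' j)).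
exists (fun k => #|Z|%:R^-1 * \sum_z \sum_i \sum_j a z i j k); split.
- move=> x; rewrite vE v'E mulr_suml.
  under [RHS]eq_bigr => k _ do rewrite -mulrA mulr_suml.
  rewrite -mulr_sumr exchange_big /=.
  transitivity (\sum_i \sum_j c i * c' j * (e i x * e j x)).
    apply: eq_bigr => i _; rewrite mulr_sumr; apply: eq_bigr => j _.
    by rewrite mulrACA.
  transitivity (#|Z|%:R^-1 * \sum_z \sum_i \sum_j c i * c' j * e (op z i j) x).
    rewrite [X in _ = _ * X]exchange_big mulr_sumr; apply: eq_bigr => i _ /=.
    rewrite [X in _ = _ * X]exchange_big mulr_sumr; apply: eq_bigr => j _ /=.
    by rewrite eM mulrCA mulr_sumr.
  congr (_ * _); apply: eq_bigr => z _.
  under [RHS]eq_bigr => k _ do rewrite mulr_suml.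
  rewrite [RHS]exchange_big /=; apply: eq_bigr => i _.
  under [RHS]eq_bigr => k _ do rewrite mulr_suml.
  rewrite [RHS]exchange_big /=; apply: eq_bigr => j _.
  rewrite (bigD1 (op z i j)) //= big1 ?addr0 /a ?eqxx ?mul1r //.
  by move=> k /negPf; rewrite eq_sym => ->; rewrite !mul0r.
- rewrite (eq_bigr (fun=> c i0 * c' i0)) => [|z _].
    by rewrite sumr_const -[(c i0 * _) *+ _]mulr_natl mulKf.
  rewrite (bigD1 i0) //= (bigD1 i0) //= /a big1 ?addr0 => [|j jn0].
    rewrite big1 ?addr0 => [|i in0].
      have [S0|/cS->] := boolP (i0 \in S); last by rewrite !(mul0r, mulr0).
      have [S'0|/c'S->] := boolP (i0 \in S'); last by rewrite !mulr0.
      by rewrite op0 // eqxx mul1r.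
    apply: big1 => j _.
    have [Si|/cS->] := boolP (i \in S); last by rewrite !(mul0r, mulr0).
    have [S'j|/c'S->] := boolP (j \in S'); last by rewrite !mulr0.
    by rewrite op0 // (negPf in0) mul0r.
  have [S0|/cS->] := boolP (i0 \in S); last by rewrite !(mul0r, mulr0).
  have [S'j|/c'S->] := boolP (j \in S'); last by rewrite !mulr0.
  by rewrite op0 // (negPf jn0) andbF mul0r.
- move=> k kS; rewrite big1 ?mulr0 // => z _; apply: big1 => i _.
  apply: big1 => j _; rewrite /a.
  have [Si|/cS->] := boolP (i \in S); last by rewrite !(mul0r, mulr0).
  have [S'j|/c'S->] := boolP (j \in S'); last by rewrite !mulr0.
  case: eqP => [kE|_]; last by rewrite mul0r.
  by rewrite -kE opS in kS.
- have cc'B : (\sum_i `|c i|) * (\sum_j `|c' j|) <= beta * beta'.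
    by apply: ler_pM => //; apply: sumr_ge0.
  apply: le_trans cc'B.
  under eq_bigr => k _ do rewrite normrM normfV normr_nat.
  rewrite -mulr_sumr ler_pdivrMl ?ltr0n // mulr_natl.
  apply: (@le_trans _ _ (\sum_k \sum_z \sum_i \sum_j `|a z i j k|)).
    apply: ler_sum => k _; apply: le_trans (ler_norm_sum _ _ _) _.
    apply: ler_sum => z _; apply: le_trans (ler_norm_sum _ _ _) _.
    by apply: ler_sum => i _; apply: ler_norm_sum.
  rewrite exchange_big /= -sumr_const; apply: ler_sum => z _.
  rewrite exchange_big /= mulr_suml; apply: ler_sum => i _.
  rewrite exchange_big /= mulr_sumr; apply: ler_sum => j _.
  rewrite (bigD1 (op z i j)) //= big1 ?addr0 /a ?eqxx ?mul1r ?normrM //.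
  by move=> k /negPf; rewrite eq_sym => ->; rewrite !mul0r normr0.
Qed.

(* The sum is the indicator function of the annihilator of [U], so [v] is the
   indicator function of its complement. *)
Lemma spectral_complement (U : {set I}) (v : X -> C) : i0 \in U ->
    (forall x, v x = e i0 x - #|U|%:R^-1 * \sum_(i in U) e i x) ->
  spectral (mem U) v (1 - #|U|%:R^-1) (2%:R * (1 - #|U|%:R^-1)).
Proof.
move=> U0 vE; have U_gt0 : (0 < #|U|)%N by apply/card_gt0P; exists i0.
have Un0 : #|U|%:R != 0 :> C by rewrite pnatr_eq0 -lt0n.
have U1 : 0 <= 1 - #|U|%:R^-1 :> C.
  by rewrite subr_ge0 invf_le1 ?ler1n ?ltr0n.
exists (fun i => (i == i0)%:R - #|U|%:R^-1 * (i \in U)%:R); split.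
- move=> x; rewrite vE; under [RHS]eq_bigr => i _ do rewrite mulrBl.
  rewrite sumrB; congr (_ - _).
    rewrite (bigD1 i0) //= big1 ?addr0 ?eqxx ?mul1r // => i /negPf->.
    by rewrite mul0r.
  rewrite mulr_sumr big_mkcond; apply: eq_bigr => i _.
  by case: (i \in U); rewrite ?mulr1 // mulr0 mul0r.
- by rewrite eqxx U0 mulr1.
- move=> i /negbTE; have -> : (i \in mem U) = (i \in U) by [].
  by move=> iU; rewrite iU mulr0 subr0; case: eqP iU => // ->; rewrite U0.
- rewrite (bigD1 i0) //= eqxx U0 mulr1 ger0_norm //.
  rewrite (eq_bigr (fun i => (i \in U)%:R * #|U|%:R^-1)) => [|i /negPf->]; last first.
    by rewrite sub0r normrN normrM normfV !normr_nat mulrC.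
  rewrite -mulr_suml mulr_natl mulr2n lerD2l.
  have -> : \sum_(i | i != i0) (i \in U)%:R = #|U|%:R - 1 :> C.
    apply/eqP; rewrite eq_sym subr_eq addrC; apply/eqP.
    rewrite -sum1_card natr_sum [LHS]big_mkcond (bigD1 i0) //= U0; congr (_ + _).
    by apply: eq_bigr => i _; case: (i \in U).
  by rewrite mulrBl mulfV // mul1r.
Qed.

Lemma spectral_base (v : X -> C) : (forall x, v x = e i0 x) -> spectral (pred1 i0) v 1 1.
Proof.
move=> vE; exists (fun i => (i == i0)%:R); split => [x||i|]; rewrite ?eqxx //.
- rewrite vE (bigD1 i0) //= eqxx mul1r big1 ?addr0 // => i /negPf->.
  by rewrite mul0r.
- by rewrite inE => /negPf->.
rewrite (bigD1 i0) //= eqxx normr1 big1 ?addr0 // => i /negPf->.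
by rewrite normr0.
Qed.

(** The factor [e i0] is carried along because the trivial multiplicative character vanishes at 0,
    so it is idempotent but not constantly 1. Independence is asked for all subsequences to feed the
    induction on [s]. *)
Lemma spectral_prod (T : eqType) (U : T -> {set I}) (S : seq T -> {pred I})
    (s : seq T) (h : T -> X -> C) :
    (forall x, e i0 x * e i0 x = e i0 x) ->
    S [::] =i pred1 i0 -> (forall t, t \in s -> i0 \in U t) ->
    (forall t x, t \in s ->
       h t x * e i0 x = e i0 x - #|U t|%:R^-1 * \sum_(i in U t) e i x) ->
    (forall t r, subseq (t :: r) s -> forall z i j, i \in U t -> j \in S r ->
       op z i j \in S (t :: r) /\ (op z i j == i0) = (i == i0) && (j == i0)) ->
  spectral (S s) (fun x => (\prod_(t <- s) h t x) * e i0 x)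
    (\prod_(t <- s) (1 - #|U t|%:R^-1))
    (2%:R ^+ size s * \prod_(t <- s) (1 - #|U t|%:R^-1)).
Proof.
move=> e0 S0; elim: s => [|t s IHs] U0 hE opS.
  have [c [cE c0 cS cB]] := spectral_base (fun x => erefl (e i0 x)).
  rewrite !big_nil expr0 mulr1; exists c; split => // [x|i]; last by rewrite S0; apply: cS.
  by rewrite big_nil mul1r cE.
have IH : spectral (S s) (fun x => (\prod_(t <- s) h t x) * e i0 x)
    (\prod_(t <- s) (1 - #|U t|%:R^-1))
    (2%:R ^+ size s * \prod_(t <- s) (1 - #|U t|%:R^-1)).
  apply: IHs => [u us|u x us|u r /subseq_trans/(_ (subseq_cons s t)) us].
  - by apply: U0; rewrite inE us orbT.
  - by apply: hE; rewrite inE us orbT.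
  - exact: opS.
have tts : t \in t :: s by rewrite mem_head.
have hT := spectral_complement (U0 _ tts) (fun x => hE _ x tts).
have := @spectralM _ _ (S (t :: s)) _ _ _ _ _ _ hT IH.
case=> [z i j iU jS|z i j iU jS|c [cE c0 cS cB]].
- by have [] := opS t s (subseq_refl _) z i j iU jS.
- by have [] := opS t s (subseq_refl _) z i j iU jS.
exists c; split=> // [x||]; rewrite ?big_cons //.
  by rewrite -cE /= mulrACA e0.
by rewrite [size _]/= exprS mulrACA.
Qed.

End Spectral.

(** * Multiplicative characters *)

Lemma expf_card_pred (K : finFieldType) (x : K) : x != 0 -> x ^+ #|K|.-1 = 1.
Proof.
move=> x0; apply: (mulfI x0); rewrite mulr1 -exprS prednK ?expf_card //.
by apply/card_gt0P; exists 0.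
Qed.

Lemma finField_prim_root (K : finFieldType) :
  exists g : K, #|K|.-1.-primitive_root g.
Proof.
pose s := enum [pred x : K | x != 0].
have n_gt0 : (0 < #|K|.-1)%N by rewrite -subn1 subn_gt0 finNzRing_gt1.
have sn : size s = #|K|.-1 by rewrite -cardE -(cardC1 (0 : K)).
have /hasP[g _ gP] : has (#|K|.-1).-primitive_root s.
  apply: has_prim_root; rewrite ?enum_uniq ?sn //.
  apply/allP=> x; rewrite mem_enum inE => x0.
  by rewrite unity_rootE expf_card_pred.
by exists g.
Qed.

(* [chi y] runs over all the characters of the multiplicative group when [y] runs
   over its elements; both arguments are extended by [0] at [0]. *)
Definition mult_pairing (K : finFieldType) (chi : K -> K -> algC) :=
  [/\ forall y y' x, chi (y * y') x = chi y x * chi y' x,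
      forall x y, chi x y = chi y x,
      (forall x, chi 0 x = 0) /\ (forall x, x != 0 -> chi 1 x = 1),
      forall x y, x != 0 -> y != 0 -> `|chi y x| = 1
    & forall y, y != 0 -> y != 1 -> exists2 x, x != 0 & chi y x != 1].

(** The group is cyclic: with [lg] the discrete logarithm to base [g] and [z] a complex root of
    unity of the same order, [z ^+ (lg y * lg x)] is symmetric, multiplicative and nondegenerate. *)
Lemma mult_pairing_exists (K : finFieldType) : exists chi, @mult_pairing K chi.
Proof.
have n_gt0 : (0 < #|K|.-1)%N by rewrite -subn1 subn_gt0 finNzRing_gt1.
have [g gP] := finField_prim_root K; have [z zP] := C_prim_root_exists n_gt0.
pose lg (x : K) := index x [seq g ^+ i | i <- iota 0 #|K|.-1].
have lgK x : x != 0 -> g ^+ lg x = x.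
  move=> x0; have xs : x \in [seq g ^+ i | i <- iota 0 #|K|.-1].
    have [i ->] := prim_rootP gP (expf_card_pred x0).
    by apply/mapP; exists (nat_of_ord i); rewrite // mem_iota ltn_ord.
  rewrite -[RHS](nth_index 0 xs) (nth_map 0%N) ?nth_iota //.
    by move: xs; rewrite -index_mem size_map size_iota.
  by move: xs; rewrite -index_mem size_map.
have eqz i j : g ^+ i = g ^+ j -> z ^+ i = z ^+ j.
  move/eqP; rewrite (eq_prim_root_expr gP) => ij.
  by apply/eqP; rewrite (eq_prim_root_expr zP).
have g0 : g != 0.
  apply/eqP=> g0; move/eqP: (prim_expr_order gP).
  by rewrite g0 expr0n (gtn_eqF n_gt0) eq_sym oner_eq0.
pose chi y x : algC := if (x == 0) || (y == 0) then 0 else z ^+ (lg y * lg x).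
exists chi; split.
- move=> y y' x; rewrite /chi mulf_eq0.
  have [_|x0] := eqVneq x 0; first by rewrite mul0r.
  have [_|y0] := eqVneq y 0; first by rewrite mul0r.
  have [_|y'0] := eqVneq y' 0; first by rewrite mulr0.
  rewrite /= -exprD -mulnDl !exprM.
  by congr (_ ^+ _); apply: eqz; rewrite exprD !lgK ?mulf_neq0.
- by move=> x y; rewrite /chi orbC mulnC.
- split=> x; first by rewrite /chi eqxx orbT.
  move=> x0; rewrite /chi (negPf x0) oner_eq0 exprM.
  by rewrite (eqz (lg 1) 0%N) ?expr0 ?expr1n // lgK ?oner_neq0.
- move=> x y x0 y0; rewrite /chi (negPf x0) (negPf y0) normrX.
  suff -> : `|z| = 1 by rewrite expr1n.
  have /eqP := congr1 (@Num.norm _ algC) (prim_expr_order zP).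
  by rewrite normrX normr1 pexpr_eq1 // => /eqP.
- move=> y y0 y1; exists g => //; rewrite /chi (negPf y0) (negPf g0).
  rewrite mulnC exprM (eqz (lg g) 1%N) ?lgK // expr1.
  apply: contraNneq y1 => z1; rewrite -(lgK _ y0) -(expr0 g).
  by rewrite (eq_prim_root_expr gP) -(eq_prim_root_expr zP) z1.
Qed.

Section MultSpectral.

Variables (K : finFieldType) (chi : K -> K -> algC).
Hypothesis chiP : mult_pairing chi.

Let n := #|K|.-1.
Let n_gt0 : (0 < n)%N. Proof. by rewrite /n -subn1 subn_gt0 finNzRing_gt1. Qed.
Let chiM y y' x : chi (y * y') x = chi y x * chi y' x. Proof. by case: chiP. Qed.
Let chiC x y : chi x y = chi y x. Proof. by case: chiP. Qed.
Let chi0 x : chi 0 x = 0. Proof. by case: chiP => _ _ []. Qed.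
Let chi1 x : x != 0 -> chi 1 x = 1. Proof. by case: chiP => _ _ [_ h] _ _; apply: h. Qed.

Lemma mult_pairingX y x d : x != 0 -> chi (y ^+ d) x = chi y x ^+ d.
Proof.
by move=> x0; elim: d => [|d IHd]; rewrite ?expr0 ?chi1 // !exprS chiM IHd.
Qed.

Lemma mult_pairing_sum y : y != 0 -> y != 1 -> \sum_x chi y x = 0.
Proof.
move=> y0 y1; have [x0 x0n chin1] : exists2 x, x != 0 & chi y x != 1.
  by case: chiP => _ _ _ _; apply.
apply/eqP; have : (1 - chi y x0) * \sum_x chi y x == 0.
  rewrite mulrBl mul1r subr_eq0 {1}(reindex_onto ( *%R x0) ( *%R x0^-1)) /=.
    rewrite mulr_sumr (eq_bigl xpredT) => [|x]; last by rewrite mulKf ?eqxx.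
    by apply/eqP/eq_bigr => x _; rewrite chiC chiM !(chiC _ y).
  by move=> x _; rewrite mulVKf.
by rewrite mulf_eq0 subr_eq0 eq_sym (negPf chin1).
Qed.

Definition powers (d : nat) : {set K} := [set z ^+ d | z in [set z | z != 0]].

Lemma powers_neq0 d y : y \in powers d -> y != 0.
Proof. by case/imsetP=> z; rewrite inE => z0 ->; rewrite expf_neq0. Qed.

Lemma powers1 d : 1 \in powers d.
Proof. by apply/imsetP; exists 1; rewrite ?inE ?oner_neq0 ?expr1n. Qed.

(** The exponent moves across the pairing, so [x] is orthogonal to all [d]-th powers exactly when
    [x ^+ d] pairs trivially with everything, that is, equals 1. For d = n / l this says that [x] is
    an l-th power. *)
Lemma sum_powers d x : x != 0 ->
  \sum_(y in powers d) chi y x = (x ^+ d == 1)%:R * #|powers d|%:R.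
Proof.
move=> x0; have [xd1|xdn1] := eqVneq (x ^+ d) 1.
  rewrite mul1r -sum1_card natr_sum; apply: eq_bigr => y /imsetP[z].
  rewrite inE => z0 ->; rewrite mult_pairingX // chiC -mult_pairingX //.
  by rewrite xd1 chi1.
have [z z0 chin1] : exists2 z, z != 0 & chi (x ^+ d) z != 1.
  by case: chiP => _ _ _ _; apply; rewrite ?expf_neq0.
apply/eqP; rewrite mul0r; set S := \sum_(y in _) _.
have : (1 - chi (z ^+ d) x) * S == 0.
  have zd0 : z ^+ d != 0 by rewrite expf_neq0.
  rewrite mulrBl mul1r subr_eq0 {1}/S.
  rewrite (reindex_onto ( *%R (z ^+ d)) ( *%R (z ^+ d)^-1)) /=; last first.
    by move=> y _; rewrite mulVKf.
  rewrite mulr_sumr; apply/eqP; apply: eq_big => [y|y _]; last by rewrite chiM.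
  rewrite mulKf // eqxx andbT; apply/imsetP/imsetP => -[u]; rewrite inE => u0.
    move=> yE; exists (u / z); first by rewrite inE mulf_neq0 ?invr_eq0.
    by rewrite exprMn -yE exprVn mulrC mulKf.
  by move->; exists (z * u); rewrite ?exprMn // inE mulf_neq0.
rewrite mulf_eq0 subr_eq0 eq_sym mult_pairingX // chiC -mult_pairingX //.
by rewrite (negPf chin1).
Qed.

(** Summing the pairing over all nonzero elements and all [d]-th powers, in both orders, gives
    [#|powers d| * #|H| = n], where [H], the [d]-th roots of unity, has at most [d] elements. *)
Lemma leq_card_powers l : (l %| n)%N -> (l <= #|powers (n %/ l)|)%N.
Proof.
move=> ln; pose d := (n %/ l)%N; pose H := [set x : K | (x != 0) && (x ^+ d == 1)].
have d_gt0 : (0 < d)%N by rewrite divn_gt0 ?(dvdn_gt0 n_gt0 ln) // dvdn_leq.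
have Hd : (#|H| <= d)%N.
  rewrite cardE; apply: max_unity_roots => //; last exact: enum_uniq.
  apply/allP=> x; rewrite mem_enum inE unity_rootE; by case/andP.
have UH : (#|powers d| * #|H| = n)%N.
  apply/eqP; rewrite -(eqr_nat algC).
  have <- : \sum_(x | x != 0) \sum_(y in powers d) chi y x = (#|powers d| * #|H|)%:R.
    rewrite (eq_bigr (fun x => (x ^+ d == 1)%:R * #|powers d|%:R)); last first.
      by move=> x /sum_powers.
    rewrite -mulr_suml natrM mulrC; congr (_ * _); rewrite -[#|H|]sum1_card natr_sum.
    rewrite [RHS](eq_bigl (fun x => (x != 0) && (x ^+ d == 1))) => [|x]; last first.
      by rewrite inE.
    by rewrite big_mkcondr; apply: eq_bigr => x _; case: eqP.
  rewrite exchange_big (bigD1 1) ?powers1 //= [X in _ + X]big1 ?addr0.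
    rewrite (eq_bigr (fun=> 1)) => [|x /chi1//].
    by rewrite sumr_const cardC1.
  move=> y /andP[/powers_neq0 y0 y1]; have := mult_pairing_sum y0 y1.
  by rewrite (bigD1 0) //= chiC chi0 add0r.
by rewrite -(leq_pmul2r d_gt0) /d mulnC divnK // -[leqLHS]UH leq_mul2l Hd orbT.
Qed.

Lemma mult_spectral (s : seq nat) : uniq s -> all prime s ->
    all (dvdn^~ n) s ->
  spectral chi 1 [pred y | (y != 0) && (y ^+ (\prod_(l <- s) l) == 1)]
    (fun x => (\prod_(l <- s) (x ^+ (n %/ l) != 1)%:R) * chi 1 x)
    (\prod_(l <- s) (1 - #|powers (n %/ l)|%:R^-1))
    (2%:R ^+ size s * \prod_(l <- s) (1 - #|powers (n %/ l)|%:R^-1)).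
Proof.
move=> us ps ds.
apply: (@spectral_prod algC K K unit chi (fun _ => *%R) 1 _ _ _
  (fun l => powers (n %/ l))
  (fun s => [pred y | (y != 0) && (y ^+ (\prod_(l <- s) l) == 1)])).
- by rewrite card_unit.
- move=> i j x; rewrite card_unit invr1 mul1r big_const card_unit /= addr0.
  by rewrite chiM.
- by move=> x; rewrite -chiM mulr1.
- move=> y; rewrite !inE big_nil expr1.
  by have [->|] := eqVneq y 1; rewrite ?oner_eq0 ?andbF.
- by move=> l _; apply: powers1.
- move=> l x ls; have [->|x0] := eqVneq x 0.
    rewrite chiC chi0 mulr0 big1 ?mulr0 ?subr0 // => y _.
    by rewrite chiC chi0.
  rewrite sum_powers // chi1 // mulr1; case: eqP => _ /=.
    by rewrite mul1r mulVf ?subrr // pnatr_eq0 -lt0n;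
       apply/card_gt0P; exists 1; apply: powers1.
  by rewrite mul0r mulr0 subr0.
- move=> l r lr _ i j iU; rewrite !inE => /andP[j0 /eqP jr].
  have ls : l \in s by rewrite (mem_subseq lr) ?mem_head.
  have pl : prime l := allP ps _ ls; have ln : (l %| n)%N by apply: (allP ds).
  have i0 := powers_neq0 iU.
  have il : i ^+ l = 1.
    case/imsetP: iU => z; rewrite inE => z0 ->.
    by rewrite -exprM divnK // expf_card_pred.
  have co : coprime l (\prod_(k <- r) k).
    have : l \notin r by have := subseq_uniq lr us; case/andP.
    have : {subset r <= s} by move=> k kr; rewrite (mem_subseq lr) ?inE ?kr ?orbT.
    elim: r {lr jr} => [|k r IHr] rs; first by rewrite big_nil coprimen1.
    rewrite inE negb_or big_cons => /andP[lk lr].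
    rewrite coprimeMr IHr // => [|u ur]; last by apply: rs; rewrite inE ur orbT.
    rewrite andbT prime_coprime // dvdn_prime2 //.
    by apply: (allP ps); apply: rs; rewrite mem_head.
  split.
    by rewrite mulf_neq0 //= big_cons exprMn exprM il expr1n mul1r mulnC exprM
      jr expr1n.
  apply/idP/idP => [/eqP ij|/andP[/eqP-> /eqP->]]; last by rewrite mulr1.
  (* Here [i] is the inverse of [j], so its order divides both [l] and the product of the other
     primes. *)
  have ir : i ^+ (\prod_(k <- r) k) = 1.
    by rewrite -[LHS]mulr1 -jr -exprMn ij expr1n.
  have i1 : i = 1.
    have l_gt0 := prime_gt0 pl.
    have [a b ab _] := egcdnP (\prod_(k <- r) k) l_gt0.
    have := congr1 (fun e => i ^+ e) ab; rewrite (eqP co) exprD.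
    by rewrite mulnC exprM il expr1n [(b * _)%N]mulnC exprM ir expr1n mul1r.
  by rewrite i1 eqxx -(mul1r j) -{1}i1 ij eqxx.
Qed.

End MultSpectral.

(** * Polynomials in the Frobenius map *)

Section FrobeniusAction.

Variables (F K : finFieldType) (iota : {rmorphism F -> K}).
Let q := #|F|.

Lemma card_pnat_pchar : [pchar K].-nat q.
Proof.
have [p pr_p pF] := finPcharP F.
have pK : p \in [pchar K] := rmorph_pchar iota pF.
rewrite (eq_pnat _ (pcharf_eq pK)) /q.
by have := pprimeChar_pgroup pF; rewrite /pgroup cardsT.
Qed.

Lemma exprD_qpow i (x y : K) : (x + y) ^+ (q ^ i) = x ^+ (q ^ i) + y ^+ (q ^ i).
Proof. by apply: exprDn_pchar; rewrite pnatX card_pnat_pchar. Qed.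

Lemma expr_sum_qpow i (T : finType) (f : T -> K) :
  (\sum_t f t) ^+ (q ^ i) = \sum_t f t ^+ (q ^ i).
Proof.
have q_gt0 : (0 < q)%N by apply/card_gt0P; exists 0.
elim/big_rec2: _ => [|t y x _ <-]; last exact: exprD_qpow.
by rewrite expr0n expn_eq0 (gtn_eqF q_gt0).
Qed.

Lemma iota_qpow i (a : F) : iota a ^+ (q ^ i) = iota a.
Proof.
rewrite -rmorphXn; congr (iota _); elim: i => [|i IHi]; first by rewrite expr1.
by rewrite expnSr exprM IHi expf_card.
Qed.

(** Otherwise X^q - X would have q + 1 roots: [x] and the image of [F]. *)
Lemma iota_fixed (x : K) : x ^+ q = x -> exists a, x = iota a.
Proof.
move=> xq; pose s := [seq iota a | a <- enum F].
have [/mapP[a _ ->]|xs] := boolP (x \in s); first by exists a.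
have q_gt1 : (1 < q)%N by apply: finNzRing_gt1.
have sP : size ('X^q - 'X : {poly K}) = q.+1.
  by rewrite size_polyDl ?size_polyXn // size_polyN size_polyX.
have := @max_poly_roots _ ('X^q - 'X : {poly K}) (x :: s).
rewrite -size_poly_eq0 sP /= size_map -cardE -/q ltnn => /(_ isT) H.
suff: false by []; apply: H.
  rewrite rootE !hornerE xq subrr eqxx /=; apply/allP=> y /mapP[a _ ->].
  by rewrite rootE !hornerE -[q]expn1 iota_qpow subrr.
by rewrite xs map_inj_uniq ?enum_uniq //; apply: fmorph_inj.
Qed.

Implicit Types (P Q : {poly F}) (x y : K).

(* [P] applied to the map [x |-> x ^+ t]: the Frobenius map for [t = q], its
   inverse, which is also its adjoint for the trace form, for
   [t = q ^ m.-1]. *)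
Definition frob (t : nat) (P : {poly F}) (x : K) :=
  \sum_(i < size P) iota P`_i * x ^+ (t ^ i).

Lemma frobE t P x n : (size P <= n)%N ->
  frob t P x = \sum_(i < n) iota P`_i * x ^+ (t ^ i).
Proof.
move=> sn; rewrite /frob (big_ord_widen _ (fun i => iota P`_i * x ^+ (t ^ i)) sn).
rewrite big_mkcond; apply: eq_bigr => i _; case: ltnP => // si.
by rewrite nth_default // rmorph0 mul0r.
Qed.

Lemma frob0 t x : frob t 0 x = 0.
Proof. by rewrite (@frobE t _ _ 0) ?size_poly0 // big_ord0. Qed.

Lemma frobDl t P Q x : frob t (P + Q) x = frob t P x + frob t Q x.
Proof.
rewrite (frobE _ _ (size_polyD P Q)) (frobE _ _ (leq_maxl (size P) (size Q))).
rewrite (frobE _ _ (leq_maxr (size P) (size Q))).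
by rewrite -big_split; apply: eq_bigr => i _; rewrite coefD rmorphD mulrDl.
Qed.

Lemma frobC t c x : frob t c%:P x = iota c * x.
Proof.
by rewrite (@frobE t _ x 1) ?size_polyC_leq1 // big_ord1 coefC eqxx expn0 expr1.
Qed.

Lemma frobMX t P x : frob t (P * 'X) x = frob t P (x ^+ t).
Proof.
rewrite (@frobE t (P * 'X) x (size P).+1); last first.
  by apply: leq_trans (size_polyMleq _ _) _; rewrite size_polyX addn2.
rewrite big_ord_recl coefMX /= rmorph0 mul0r add0r; apply: eq_bigr => i _.
by rewrite coefMX /= expnS exprM.
Qed.

Section QPower.
Variable j : nat.
Let t := (q ^ j)%N.

Lemma frobDr P x y : frob t P (x + y) = frob t P x + frob t P y.
Proof.
rewrite -big_split; apply: eq_bigr => i _ /=.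
by rewrite -expnM exprD_qpow mulrDr.
Qed.

Lemma frob0r P : frob t P 0 = 0.
Proof. by apply: (addrI (frob t P 0)); rewrite -frobDr !addr0. Qed.

Lemma frobZr P c x : frob t P (iota c * x) = iota c * frob t P x.
Proof.
rewrite mulr_sumr; apply: eq_bigr => i _ /=.
by rewrite exprMn -expnM iota_qpow mulrCA.
Qed.

Lemma frob_pow P x : frob t P (x ^+ t) = frob t P x ^+ t.
Proof.
rewrite expr_sum_qpow; apply: eq_bigr => i _.
by rewrite exprMn iota_qpow exprAC.
Qed.

(** The coefficients, being in [F], are fixed by the power map, so they commute with it and
    polynomials act through a commutative ring. *)
Lemma frobM P Q x : frob t (P * Q) x = frob t P (frob t Q x).
Proof.
elim/poly_ind: P x => [|P c IHP] x; first by rewrite mul0r !frob0.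
rewrite mulrDl !frobDl !frobC mul_polyC -mulrA [_ * Q]mulrC mulrA !frobMX IHP frob_pow.
congr (_ + _); rewrite -mul_polyC.
elim/poly_ind: Q x {P IHP} => [|Q d IHQ] x.
  by rewrite mulr0 !frob0 mulr0.
by rewrite mulrDr mulrA !frobDl !frobMX IHQ -polyCM !frobC rmorphM mulrDr mulrA.
Qed.

End QPower.

(** The kernel is the set of roots of the linearized polynomial [R], whose degree is
    [q ^ (size P).-1]. *)
Lemma card_ker_act P : P != 0 ->
  (#|[set x | frob q P x == 0%R]| <= q ^ (size P).-1)%N.
Proof.
move=> P0; have q_gt1 : (1 < q)%N by apply: finNzRing_gt1.
pose R : {poly K} := \sum_(i < size P) iota P`_i *: 'X^(q ^ i).
have sP : (0 < size P)%N by rewrite lt0n size_poly_eq0.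
have RP : R != 0.
  apply/eqP=> /(congr1 (fun p : {poly K} => p`_(q ^ (size P).-1))).
  have lt_s : ((size P).-1 < size P)%N by rewrite prednK.
  rewrite coef0 coef_sum (bigD1 (Ordinal lt_s)) //= coefZ coefXn eqxx mulr1.
  rewrite big1 ?addr0 => [/eqP|i].
    by rewrite fmorph_eq0 -lead_coefE lead_coef_eq0 (negPf P0).
  rewrite -val_eqE /= coefZ coefXn eqn_exp2l // eq_sym => /negPf->.
  by rewrite mulr0.
have sR : (size R <= (q ^ (size P).-1).+1)%N.
  apply: leq_trans (size_sum _ _ _) _; apply/bigmax_leqP=> i _.
  apply: leq_trans (size_scale_leq _ _) _; rewrite size_polyXn ltnS.
  by rewrite leq_exp2l // -ltnS prednK.
rewrite -ltnS; apply: leq_trans sR; rewrite cardE; apply: max_poly_roots => //.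
  apply/allP=> x; rewrite mem_enum inE rootE /R horner_sum.
  by under eq_bigr => i _ do rewrite hornerZ hornerXn.
exact: enum_uniq.
Qed.

End FrobeniusAction.

(** * Additive characters *)

Section AddSpectral.

Variables (F K : finFieldType) (iota : {rmorphism F -> K}) (m : nat).
Let q := #|F|.
Hypotheses (m_gt0 : (0 < m)%N) (cardK : #|K| = (q ^ m)%N).
Implicit Types (P : {poly F}) (a c : F) (b x y : K).

Let q_gt1 : (1 < q)%N. Proof. exact: finNzRing_gt1. Qed.
Let q_gt0 : (0 < q)%N. Proof. exact: ltnW. Qed.
Let q1_gt0 : (0 < q.-1)%N. Proof. by rewrite -subn1 subn_gt0. Qed.

Lemma expr_qmul i x : x ^+ (q ^ (m * i)) = x.
Proof.
rewrite expnM; elim: i => [|i IHi]; first by rewrite expr1.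
by rewrite expnS exprM -cardK expf_card cardK.
Qed.

Definition ftrace x := \sum_(i < m) x ^+ (q ^ i).

Lemma ftraceD x y : ftrace (x + y) = ftrace x + ftrace y.
Proof. by rewrite -big_split; apply: eq_bigr => i _; rewrite (exprD_qpow iota). Qed.

Lemma ftraceZ c x : ftrace (iota c * x) = iota c * ftrace x.
Proof. by rewrite mulr_sumr; apply: eq_bigr => i _; rewrite exprMn iota_qpow. Qed.

Lemma ftrace0 : ftrace 0 = 0.
Proof. by apply: (addrI (ftrace 0)); rewrite -ftraceD !addr0. Qed.

Lemma ftrace_sum (T : finType) (f : T -> K) : ftrace (\sum_i f i) = \sum_i ftrace (f i).
Proof. exact: (big_morph ftrace ftraceD ftrace0). Qed.

Lemma ftrace_pow j x : ftrace (x ^+ (q ^ j)) = ftrace x.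
Proof.
elim: j x => [|j IHj] x; first by rewrite expr1.
rewrite expnS exprM IHj /ftrace; have := expr_qmul 1 x; rewrite muln1.
case: m m_gt0 => // m' _ xm.
rewrite big_ord_recr big_ord_recl /= expr1 addrC -exprM -expnS xm; congr (_ + _).
by apply: eq_bigr => i _; rewrite -exprM -expnS.
Qed.

Lemma ftrace_iota x : exists a, ftrace x = iota a.
Proof.
apply: iota_fixed; rewrite -/q -[q]expn1 (expr_sum_qpow iota) -[RHS](ftrace_pow 1).
by apply: eq_bigr => i _; rewrite exprAC.
Qed.

(** The trace is the action of 1 + X + ... + X^(m-1), whose kernel has at most q^(m-1) elements. *)
Lemma ftrace_nondeg b : b != 0 -> exists x, ftrace (b * x) != 0.
Proof.
move=> b0; pose P : {poly F} := \poly_(i < m) 1.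
have sP : size P = m.
  by apply: size_poly_eq; rewrite oner_neq0.
have ftraceE x : ftrace x = frob iota q P x.
  rewrite /frob sP; apply: eq_bigr => i _.
  by rewrite coef_poly ltn_ord rmorph1 mul1r.
have [x trx|ftrace0] := pickP (fun x => ftrace x != 0).
  by exists (x / b); rewrite mulrC divfK.
have P0 : P != 0 by rewrite -size_poly_eq0 sP -lt0n.
have := card_ker_act iota P0.
rewrite (_ : [set x | _] = [set: K]) ?cardsT ?cardK ?sP; last first.
  by apply/setP=> x; rewrite !inE -ftraceE; apply/negPn; rewrite ftrace0.
by rewrite leq_exp2l // -ltnS prednK // ltnn.
Qed.

Let t := (q ^ m.-1)%N.

Lemma ftrace_adj P b x : ftrace (b * frob iota q P x) = ftrace (frob iota t P b * x).
Proof.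
rewrite /frob mulr_sumr mulr_suml !ftrace_sum; apply: eq_bigr => i _.
rewrite mulrCA -mulrA !ftraceZ; congr (_ * _).
(* The trace is invariant under q-powers. Raising to the power [q ^ (m.-1 * i)] undoes [q ^ i] on
   [x], since the exponents add up to [m * i]. *)
rewrite -[LHS](ftrace_pow (m.-1 * i)) exprMn expnM -/t; congr (ftrace (_ * _)).
rewrite -exprM /t -expnM -expnD -[X in (X + _)%N]mul1n -mulnDl add1n prednK //.
exact: expr_qmul.
Qed.

(* The average of [psi (c * ftrace (b * x))] over the nonzero scalars [c], for any
   nontrivial additive character [psi] of [F]. *)
Definition tchar b x : algC := if ftrace (b * x) == 0 then 1 else - q.-1%:R^-1.

Local Notation E := tchar.

Lemma tcharC b x : E b x = E x b. Proof. by rewrite /tchar mulrC. Qed.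

Let eF (c : F) : algC := if c == 0 then 1 else - q.-1%:R^-1.

Let E_iota b x a : ftrace (b * x) = iota a -> E b x = eF a.
Proof. by rewrite /tchar /eF => ->; rewrite fmorph_eq0. Qed.

Let sum_eF : \sum_c eF c = 0.
Proof.
rewrite (bigD1 0) //= /eF eqxx (eq_bigr (fun=> - q.-1%:R^-1)) => [|c /negPf->//].
rewrite sumr_const cardC1 -/q -[(- _) *+ _]mulr_natl mulrN mulfV ?subrr //.
by rewrite pnatr_eq0 -lt0n.
Qed.

Let sum_eF_affine c a : a != 0 -> \sum_d eF (c + d * a) = 0.
Proof.
move=> a0; rewrite -[RHS]sum_eF.
rewrite [RHS](reindex_onto (fun d => c + d * a) (fun d => (d - c) / a)) /=.
  by apply: eq_bigl => d; rewrite addrAC subrr add0r mulfK ?eqxx.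
by move=> d _; rewrite divfK // addrC subrK.
Qed.

Definition nonzero := {c : F | c \in [pred c | c != 0]}.

Local Notation Z := nonzero.

Lemma card_nonzero : #|{: Z}| = q.-1.
Proof.
by rewrite card_sig -(cardC1 (0 : F)); apply: eq_card => c; rewrite !inE.
Qed.

(** Let c and a be the two traces. If a = 0, all the terms on the right are equal. Otherwise c + z a
    takes every value but c when z runs over the nonzero scalars, and the values of [eF] sum to
    0. *)
Lemma tcharM b b' x :
  E b x * E b' x = #|{: Z}|%:R^-1 * \sum_(z : Z) E (b + iota (val z) * b') x.
Proof.
have [c tc] := ftrace_iota (b * x); have [a ta] := ftrace_iota (b' * x).
have ftraceE z : ftrace ((b + iota z * b') * x) = iota (c + z * a).
  by rewrite mulrDl -mulrA ftraceD ftraceZ tc ta rmorphD rmorphM.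
rewrite (E_iota tc) (E_iota ta).
rewrite -(@big_sub _ _ _ _ [pred c : F | c != 0] (fun z => E (b + iota z * b') x)) card_nonzero.
rewrite (eq_bigr (fun z => eF (c + z * a))) => [|z _]; last exact: E_iota (ftraceE z).
have q1n0 : q.-1%:R != 0 :> algC by rewrite pnatr_eq0 -lt0n.
have [->|a0] := eqVneq a 0.
  rewrite (eq_bigr (fun=> eF c)) => [|z _]; last by rewrite mulr0 addr0.
  by rewrite sumr_const cardC1 -[eF c *+ _]mulr_natl mulKf // {2}/eF eqxx mulr1.
have := sum_eF_affine c a0; rewrite (bigD1 0) //= mul0r addr0 => /eqP.
rewrite addrC addr_eq0 => /eqP ->; rewrite {2}/eF (negPf a0) mulrN mulrC.
by rewrite mulrN.
Qed.

(** If some [b0] in [U] is not orthogonal to [x], the sum is unchanged by the translations by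
    multiples of [b0], and adding up all these translates kills every term. *)
Lemma sum_tchar_subspace (U : {set K}) x :
    (forall c u v, u \in U -> v \in U -> u + iota c * v \in U) ->
  \sum_(b in U) E b x = [forall b in U, ftrace (b * x) == 0]%:R * #|U|%:R.
Proof.
move=> UP; case: forall_inP => [Ux|/forall_inP].
  rewrite mul1r -sum1_card natr_sum; apply: eq_bigr => b /Ux.
  by rewrite /tchar => ->.
rewrite negb_forall_in => /exists_inP[b0 b0U tb0]; rewrite mul0r.
have [a ta] := ftrace_iota (b0 * x).
have a0 : a != 0 by apply: contraNneq tb0 => a0; rewrite ta a0 rmorph0.
set S := \sum_(b in _) _.
have SE c : \sum_(b in U) E (b + iota c * b0) x = S.
  rewrite [RHS](reindex_onto (fun b => b + iota c * b0) (fun b => b - iota c * b0)) /=.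
    apply: eq_bigl => b; rewrite addrK eqxx andbT; apply/idP/idP => [bU|].
      exact: UP.
    by move/(UP (- c))/(_ b0U); rewrite rmorphN mulNr addrK.
  by move=> b _; rewrite subrK.
have : \sum_(c : F) S = 0.
  rewrite -(eq_bigr _ (fun c _ => SE c)) exchange_big /= big1 // => b _.
  have [c tc] := ftrace_iota (b * x); rewrite -[RHS](sum_eF_affine c a0).
  apply: eq_bigr => d _; apply: E_iota.
  by rewrite mulrDl -mulrA ftraceD ftraceZ tc ta rmorphD rmorphM.
rewrite sumr_const => /eqP; rewrite mulrn_eq0 -[#|F|]/q (gtn_eqF q_gt0) /=.
by move/eqP.
Qed.

Lemma sum_tchar b : b != 0 -> \sum_x E b x = 0.
Proof.
move=> b0; under eq_bigr => x _ do rewrite tcharC.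
rewrite (eq_bigl (fun x => x \in [set: K])) => [|x]; last by rewrite inE.
rewrite sum_tchar_subspace => [|c u v _ _]; last by rewrite inE.
case: forall_inP => [h|_]; last by rewrite mul0r.
have [x] := ftrace_nondeg b0; rewrite mulrC => /negP[]; apply: h.
by rewrite inE.
Qed.

Definition cof P := ('X^m - 1) %/ P.
(* The orthogonal, for the trace form, of the kernel of [cof P] (see
   [coker_perp]). *)
Definition coker P : {set K} := [set frob iota t (cof P) c | c : K].

Lemma coker_subspace P c u v : u \in coker P -> v \in coker P ->
  u + iota c * v \in coker P.
Proof.
move=> /imsetP[u' _ ->] /imsetP[v' _ ->].
by rewrite -frobZr -frobDr; apply: imset_f.
Qed.

Lemma coker0 P : 0 \in coker P.
Proof. by apply/imsetP; exists 0; rewrite ?frob0r. Qed.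

Lemma coker_perp P x :
  [forall b in coker P, ftrace (b * x) == 0] = (frob iota q (cof P) x == 0).
Proof.
apply/forall_inP/eqP => [h|Px b /imsetP[c _ ->]]; last first.
  by rewrite -ftrace_adj Px mulr0 ftrace0.
apply/eqP; apply: contraT => /ftrace_nondeg[c]; rewrite mulrC ftrace_adj.
by rewrite (eqP (h _ _)) ?eqxx //; apply: imset_f.
Qed.

(** The double counting of [leq_card_powers] again: the orthogonal of [coker P] is the kernel of
    [cof P], bounded by [card_ker_act]. *)
Lemma leq_card_coker P : P %| 'X^m - 1 -> (q ^ (size P).-1 <= #|coker P|)%N.
Proof.
move=> Pm; pose V := [set x | frob iota q (cof P) x == 0].
have sm : size ('X^m - 1 : {poly F}) = m.+1.
  by rewrite size_polyDl size_polyXn // size_polyN size_poly1.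
have m0 : 'X^m - 1 != 0 :> {poly F} by rewrite -size_poly_eq0 sm.
have P0 : P != 0 by apply: contraNneq m0 => P0; move: Pm; rewrite P0 dvd0p.
have PG : P * cof P = 'X^m - 1 by rewrite mulrC divpK.
have G0 : cof P != 0 by apply: contraNneq m0 => G0; rewrite -PG G0 mulr0.
have sG : ((size P).-1 + (size (cof P)).-1 = m)%N.
  have := congr1 (fun p : {poly F} => size p) PG; rewrite sm size_mul //.
  have sP : (0 < size P)%N by rewrite size_poly_gt0.
  have sG : (0 < size (cof P))%N by rewrite size_poly_gt0.
  by rewrite -{1}(prednK sP) -{1}(prednK sG) addSn addnS => -[].
have UV : (#|coker P| * #|V| = q ^ m)%N.
  apply/eqP; rewrite -(eqr_nat algC).
  have <- : \sum_x \sum_(b in coker P) E b x = (#|coker P| * #|V|)%:R.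
    rewrite (eq_bigr (fun x => (x \in V)%:R * #|coker P|%:R)); last first.
      by move=> x _; rewrite sum_tchar_subspace ?coker_perp ?inE //; apply: coker_subspace.
    rewrite -mulr_suml natrM mulrC -[#|V|]sum1_card natr_sum; congr (_ * _).
    by rewrite [RHS]big_mkcond; apply: eq_bigr => x _; case: (x \in V).
  rewrite exchange_big (bigD1 0) ?coker0 //= [X in _ + X]big1 ?addr0.
    rewrite (eq_bigr (fun=> 1)) => [|x _]; last by rewrite /tchar mul0r ftrace0 eqxx.
    by rewrite sumr_const cardK.
  by move=> b /andP[_ /sum_tchar].
have V0 : (0 < q ^ (size (cof P)).-1)%N by rewrite expn_gt0 q_gt0.
rewrite -(leq_pmul2r V0) -expnD sG -UV leq_mul2l.
by rewrite [X in _ || X](card_ker_act iota G0) orbT.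
Qed.

(** X^m - 1 acts as zero. So [coker P] is killed by [P], and coprime polynomials will have
    independent groups of characters. *)
Lemma frob_cof P b : P %| 'X^m - 1 -> frob iota t P (frob iota t (cof P) b) = 0.
Proof.
move=> Pm; rewrite -frobM mulrC divpK // frobDl -polyC1 -polyCN frobC rmorphN rmorph1 mulN1r.
rewrite (@frobE _ _ _ _ _ _ m.+1) ?size_polyXn // big_ord_recr /= coefXn eqxx.
rewrite rmorph1 mul1r big1 ?add0r => [|i _]; last first.
  by rewrite coefXn ltn_eqF // rmorph0 mul0r.
by rewrite -expnM mulnC expr_qmul subrr.
Qed.

Lemma add_spectral (s : seq {poly F}) : pairwise (@coprimep F) s ->
    all (fun f : {poly F} => f %| 'X^m - 1) s ->
  spectral E 0 [pred b | frob iota t (\prod_(f <- s) f) b == 0]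
    (fun x => (\prod_(f <- s) (frob iota q (cof f) x != 0)%:R) * E 0 x)
    (\prod_(f <- s) (1 - #|coker f|%:R^-1))
    (2%:R ^+ size s * \prod_(f <- s) (1 - #|coker f|%:R^-1)).
Proof.
move=> cs ds.
have E0 x : E 0 x = 1 by rewrite /tchar mul0r ftrace0 eqxx.
apply: (@spectral_prod algC K K Z E (fun z b b' => b + iota (val z) * b') 0 _ _ _
  coker (fun s => [pred b | frob iota t (\prod_(f <- s) f) b == 0])).
- by rewrite card_nonzero.
- exact: tcharM.
- by move=> x; rewrite E0 mulr1.
- by move=> b; rewrite !inE big_nil -polyC1 frobC rmorph1 mul1r.
- by move=> f _; apply: coker0.
- move=> f x fs; rewrite sum_tchar_subspace; last exact: coker_subspace.
  rewrite coker_perp E0 mulr1; case: eqP => _ /=.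
    rewrite mul1r mulVf ?subrr // pnatr_eq0 -lt0n.
    by apply/card_gt0P; exists 0; apply: coker0.
  by rewrite mul0r mulr0 subr0.
- move=> f r fr z i j /imsetP[c _ ->]; rewrite !inE => /eqP jr.
  have fs : f \in s by rewrite (mem_subseq fr) ?mem_head.
  have fi := frob_cof c (allP ds _ fs); set i' := frob iota t (cof f) c in fi *.
  have frobZ0 P b : frob iota t P b = 0 -> frob iota t P (iota (val z) * b) = 0.
    by rewrite frobZr => ->; rewrite mulr0.
  split.
    rewrite big_cons frobDr [X in _ + X == _]frobM (frobZ0 _ _ jr) frob0r addr0.
    by rewrite mulrC frobM fi frob0r.
  apply/idP/idP => [/eqP ij|/andP[/eqP-> /eqP->]]; last by rewrite mulr0 addr0.
  (* Up to a scalar [i'] is [j], so it is killed by [f] and by the product of the other factors; a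
     Bezout relation concludes. *)
  have i0 : i' = 0.
    have ir : frob iota t (\prod_(k <- r) k) i' = 0.
      move/eqP: ij; rewrite addr_eq0 -mulNr -rmorphN => /eqP->.
      by rewrite frobZr jr mulr0.
    have co : coprimep f (\prod_(k <- r) k).
      have := subseq_pairwise fr cs; rewrite /= => /andP[+ _].
      elim: r {fr jr ir} => [|k r IHr]; first by rewrite big_nil coprimep1.
      by rewrite /= big_cons coprimepMr => /andP[-> /IHr].
    have /Bezout_eq1_coprimepP[[u v] /= uv] := co.
    have : frob iota t 1 i' = i' by rewrite -polyC1 frobC rmorph1 mul1r.
    by rewrite -uv frobDl !frobM fi ir !frob0r addr0.
  rewrite i0 eqxx /=; move/eqP: ij; rewrite i0 add0r mulf_eq0 fmorph_eq0.
  by have := valP z; rewrite inE => /negPf->.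
Qed.

End AddSpectral.

(** * Gauss sums and the counting estimate *)

Section Count.

Variables (F K : finFieldType) (iota : {rmorphism F -> K}) (m : nat).
Let q := #|F|.
Hypotheses (m_gt0 : (0 < m)%N) (cardK : #|K| = (q ^ m)%N).
Implicit Types (x y b : K).

Let E := @tchar F K m.
Let Z := nonzero F.
Let n := #|K|.-1.
Let n_gt0 : (0 < n)%N. Proof. by rewrite /n -subn1 subn_gt0 finNzRing_gt1. Qed.

Let E0 x : E 0 x = 1.
Proof. by rewrite /E /tchar mul0r (ftrace0 iota) eqxx. Qed.

Let EC b x : E b x = E x b. Proof. exact: tcharC. Qed.

Lemma sum_tchar_all x : \sum_b E b x = (x == 0)%:R * #|K|%:R.
Proof.
have [->|x0] := eqVneq x 0; last first.
  by under eq_bigr => b _ do rewrite EC; rewrite (sum_tchar iota) ?mul0r.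
by under eq_bigr => b _ do rewrite EC E0; rewrite sumr_const mul1r.
Qed.

Lemma sum_tcharM x x' :
  \sum_b E b x * E b x' =
  q.-1%:R^-1 * \sum_(z : Z) (x + iota (val z) * x' == 0)%:R * #|K|%:R.
Proof.
under eq_bigr => b _ do rewrite (EC b x) (EC b x') /E (tcharM iota) // card_nonzero.
rewrite -mulr_sumr exchange_big; congr (_ * _); apply: eq_bigr => z _.
by rewrite -sum_tchar_all; apply: eq_bigr => b _; rewrite -/E EC.
Qed.

Variable chi : K -> K -> algC.
Hypothesis chiP : mult_pairing chi.

Let chiM y y' x : chi (y * y') x = chi y x * chi y' x. Proof. by case: chiP. Qed.
Let chiC x y : chi x y = chi y x. Proof. by case: chiP. Qed.
Let chi0 x : chi 0 x = 0. Proof. by case: chiP => _ _ []. Qed.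
Let chi_norm x y : x != 0 -> y != 0 -> `|chi y x| = 1.
Proof. by case: chiP => _ _ _ h _; apply: h. Qed.

(** A second moment: [T 0] is 0 and the modulus of [T b] is the same for all nonzero [b], so it
    suffices to bound the sum of its squares by [n * #|K|]. The correlations of the averaged
    characters are nonnegative and, for fixed nonzero [x], add up to [#|K|], so the triangle
    inequality is sharp enough. *)
Lemma gauss_bound y b : y != 0 -> y != 1 -> b != 0 ->
  `|\sum_x chi y x * E b x| <= sqrtC #|K|%:R.
Proof.
move=> y0 y1; pose T b := \sum_x chi y x * E b x; rewrite -/(T b).
have TN c : c != 0 -> `|T c| = `|T 1|.
  move=> c0; rewrite -[LHS]mul1r -(chi_norm c0 y0) -normrM; congr (`|_|).
  rewrite mulr_sumr [RHS](reindex_onto ( *%R c) ( *%R c^-1)) /=; last first.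
    by move=> x _; rewrite mulVKf.
  apply: eq_big => [x|x _]; first by rewrite mulKf ?eqxx.
  by rewrite mulrA (chiC y (c * x)) chiM !(chiC _ y) /E /tchar mul1r.
have T0 : T 0 = 0.
  rewrite -(mult_pairing_sum chiP y0 y1); apply: eq_bigr => x _.
  by rewrite E0 mulr1.
have chi_le x : `|chi y x| <= (x != 0)%:R.
  have [->|x0] := eqVneq x 0; first by rewrite chiC chi0 normr0.
  by rewrite chi_norm.
have ET2 : \sum_b `|T b| ^+ 2 <= n%:R * #|K|%:R.
  have EJ c x : (E c x)^* = E c x.
    by rewrite /E /tchar; case: ifP => _; rewrite ?rmorph1 // rmorphN fmorphV rmorph_nat.
  have TE : \sum_b `|T b| ^+ 2 =
      \sum_x \sum_x' chi y x * (chi y x')^* * \sum_b (E b x * E b x').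
    under eq_bigr => c _ do rewrite normCK rmorph_sum mulr_suml.
    rewrite exchange_big; apply: eq_bigr => x _.
    under eq_bigr => c _ do rewrite mulr_sumr.
    rewrite exchange_big; apply: eq_bigr => x' _.
    rewrite mulr_sumr; apply: eq_bigr => c _.
    by rewrite rmorphM /= EJ mulrACA.
  apply: le_trans (real_ler_norm _) _.
    by apply: rpred_sum => c _; rewrite rpredX ?normr_real.
  rewrite TE; apply: le_trans (ler_norm_sum _ _ _) _.
  apply: (@le_trans _ _ (\sum_(x : K | x != 0) #|K|%:R)); last first.
    by rewrite sumr_const cardC1 mulr_natl.
  rewrite [leRHS]big_mkcond; apply: ler_sum => x _.
  apply: le_trans (ler_norm_sum _ _ _) _.
  have pos x' : 0 <= \sum_b E b x * E b x'.
    rewrite sum_tcharM mulr_ge0 ?invr_ge0 ?ler0n // sumr_ge0 // => z _.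
    by rewrite mulr_ge0 ?ler0n.
  apply: (@le_trans _ _ (\sum_x' (x != 0)%:R * \sum_b E b x * E b x')).
    apply: ler_sum => x' _; rewrite !normrM (ger0_norm (pos x')).
    rewrite ler_wpM2r // norm_conjC -[leRHS]mulr1.
    by rewrite ler_pM // (le_trans (chi_le x')) // lern1 leq_b1.
  rewrite -mulr_sumr; have [->|x0] := eqVneq x 0; first by rewrite mul0r.
  rewrite mul1r (eq_bigr _ (fun x' _ => sum_tcharM x x')) -mulr_sumr exchange_big /=.
  rewrite (eq_bigr (fun=> #|K|%:R)) => [|z _].
    rewrite sumr_const card_nonzero -/q -[#|K|%:R *+ _]mulr_natl mulKf // pnatr_eq0.
    by rewrite -lt0n -subn1 subn_gt0 finNzRing_gt1.
  have z0 : iota (val z) != 0 by rewrite fmorph_eq0; have := valP z; rewrite inE.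
  rewrite (bigD1 (- (x / iota (val z)))) //= mulrN mulrCA mulfV // mulr1 subrr eqxx.
  rewrite mul1r big1 ?addr0 // => x' /eqP x'n.
  case: eqP => [xE|_]; last by rewrite mul0r.
  case: x'n; move/eqP: xE; rewrite addr_eq0 => /eqP->.
  by rewrite mulNr opprK mulrAC mulfV // mul1r.
move=> b0; rewrite (TN b b0) -(ler_pXn2r (ltn0Sn 1)) ?nnegrE ?sqrtC_ge0 ?ler0n //.
rewrite sqrtCK; move: ET2; rewrite (bigD1 0) //= T0 normr0 expr0n add0r.
rewrite (eq_bigr (fun=> `|T 1| ^+ 2)) => [|c c0]; last by rewrite TN.
by rewrite sumr_const cardC1 mulr_natl ler_pMn2r.
Qed.

Definition free_normal (S : seq nat) (s : seq {poly F}) : {set K} :=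
  [set x | [&& x != 0, all (fun l => x ^+ (n %/ l) != 1) S
             & all (fun f => frob iota q (cof m f) x != 0) s]].

Lemma prod_ge0_frac (T : Type) (s : seq T) (u : T -> nat) :
  0 <= \prod_(i <- s) (1 - (u i)%:R^-1) :> algC.
Proof.
apply: prodr_ge0 => i _; rewrite subr_ge0.
by case: (u i) => [|k]; rewrite ?invr0 ?ler01 // invf_le1 ?ler1n ?ltr0n.
Qed.

Lemma card_free_normal (S : seq nat) (s : seq {poly F}) :
    uniq S -> all prime S -> all (dvdn^~ n) S ->
    pairwise (@coprimep F) s -> all (fun f : {poly F} => f %| 'X^m - 1) s ->
    s != [::] ->
  (\prod_(l <- S) (1 - #|powers K (n %/ l)|%:R^-1)) *
  (\prod_(f <- s) (1 - #|coker iota m f|%:R^-1)) *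
  (#|K|%:R - (2%:R ^+ size S - 1) * (2%:R ^+ size s - 1) * sqrtC #|K|%:R)
    <= #|free_normal S s|%:R :> algC.
Proof.
move=> uS pS dS cs ds s0.
have [a [wE a1 aS aB]] := mult_spectral chiP uS pS dS.
have [c [vE c0 cS cB]] := add_spectral iota m_gt0 cardK cs ds.
set th := \prod_(l <- S) _ in a1 aB *; set th' := \prod_(f <- s) _ in c0 cB *.
have th_ge0 : 0 <= th := prod_ge0_frac _ _.
have th'_ge0 : 0 <= th' := prod_ge0_frac _ _.
pose w x := \sum_y a y * chi y x; pose v x := \sum_b c b * E b x.
have chi1 x : chi 1 x = (x != 0)%:R.
  have [->|x0] := eqVneq x 0; first by rewrite chiC chi0.
  by case: chiP => _ _ [_ h] _ _; apply: h.
have AE : #|free_normal S s|%:R = \sum_x w x * v x.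
  rewrite -sum1_card natr_sum [LHS]big_mkcond; apply: eq_bigr => x _.
  rewrite /w /v -wE -vE -/E E0 mulr1 chi1 inE.
  have prodb (T : eqType) (r : seq T) (P : pred T) :
      \prod_(t <- r) (P t)%:R = (all P r)%:R :> algC.
    elim: r => [|t r IHr]; rewrite ?big_nil // big_cons IHr /=.
    by rewrite -natrM mulnb.
  by rewrite !prodb -!natrM !mulnb andbCA andbA; case: (_ && _).
have a0 : a 0 = 0 by apply: aS; rewrite inE eqxx.
(* Since [s] is nonempty and 0 lies in every kernel, [v] vanishes at 0; the factor [chi 1] can
   therefore be dropped from the main term. *)
have v0 : v 0 = 0.
  rewrite /v -vE; case: s s0 {cs ds th' cS cB c0 th'_ge0 vE v AE} => // f s _.
  by rewrite big_cons -[#|F|]expn1 frob0r eqxx !mul0r.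
have sum_v : \sum_x v x = th' * #|K|%:R.
  rewrite exchange_big (bigD1 0) //= c0 [X in _ + X]big1 ?addr0 => [|b b0].
    by rewrite -mulr_sumr (eq_bigr (fun=> 1)) ?sumr_const.
  by rewrite -mulr_sumr (sum_tchar iota) ?mulr0.
pose w' x := \sum_(y | y != 1) a y * chi y x.
pose v' x := \sum_(b | b != 0) c b * E b x.
have wE' x : w x = th * chi 1 x + w' x by rewrite /w (bigD1 1) //= a1.
have vE' x : v x = th' + v' x by rewrite /v (bigD1 0) //= c0 E0 mulr1.
have main : \sum_x w x * v x = th * th' * #|K|%:R + \sum_x w' x * v' x.
  transitivity (\sum_x (th * (chi 1 x * v x) + (w' x * th' + w' x * v' x))).
    by apply: eq_bigr => x _; rewrite wE' mulrDl {2}vE' mulrDr mulrA.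
  rewrite !big_split /= -mulr_sumr -mulr_suml.
  have -> : \sum_x w' x = 0.
    rewrite exchange_big big1 // => y y1 /=; rewrite -mulr_sumr.
    have [->|y0] := eqVneq y 0; first by rewrite a0 mul0r.
    by rewrite (mult_pairing_sum chiP) ?mulr0.
  rewrite mul0r add0r -mulrA -sum_v; congr (_ * _ + _).
  apply: eq_bigr => x _; rewrite chi1.
  by have [->|_] := eqVneq x 0; rewrite ?mul1r // v0 mulr0.
(* The l1-norms of [w'] and [v'] are those of the full expansions less the trivial coefficients [th]
   and [th']. *)
have err : `|\sum_x w' x * v' x| <=
    (th * (2%:R ^+ size S - 1)) * (th' * (2%:R ^+ size s - 1)) * sqrtC #|K|%:R.
  have -> : \sum_x w' x * v' x =
      \sum_(y | y != 1) \sum_(b | b != 0) (a y * c b) * \sum_x chi y x * E b x.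
    transitivity (\sum_x \sum_(y | y != 1) \sum_(b | b != 0)
       a y * c b * (chi y x * E b x)).
      apply: eq_bigr => x _; rewrite mulr_suml; apply: eq_bigr => y _.
      by rewrite mulr_sumr; apply: eq_bigr => b _; rewrite mulrACA.
    rewrite exchange_big; apply: eq_bigr => y _.
    rewrite exchange_big; apply: eq_bigr => b _.
    by rewrite mulr_sumr.
  apply: (@le_trans _ _ (\sum_(y | y != 1) \sum_(b | b != 0)
      `|a y| * `|c b| * sqrtC #|K|%:R)).
    apply: le_trans (ler_norm_sum _ _ _) _; apply: ler_sum => y y1.
    apply: le_trans (ler_norm_sum _ _ _) _; apply: ler_sum => b b0.
    rewrite !normrM; have [->|y0] := eqVneq y 0.
      by rewrite a0 normr0 !mul0r.
    by rewrite ler_wpM2l ?mulr_ge0 // gauss_bound.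
  under eq_bigr => y _ do rewrite -mulr_suml -mulr_sumr.
  rewrite -mulr_suml -mulr_suml ler_wpM2r ?sqrtC_ge0 ?ler0n //.
  apply: ler_pM; try exact: sumr_ge0.
    move: aB; rewrite (bigD1 1) //= a1 ger0_norm // addrC -lerBrDr.
    by rewrite mulrBr mulr1 mulrC.
  move: cB; rewrite (bigD1 0) //= c0 ger0_norm // addrC -lerBrDr.
  by rewrite mulrBr mulr1 mulrC.
rewrite AE main mulrBr lerD2l.
have -> : th * th' * ((2%:R ^+ size S - 1) * (2%:R ^+ size s - 1) * sqrtC #|K|%:R) =
  th * (2%:R ^+ size S - 1) * (th' * (2%:R ^+ size s - 1)) * sqrtC #|K|%:R.
  by rewrite [LHS]mulrA; congr (_ * _); rewrite mulrACA.
rewrite -lerN2 opprK; apply: le_trans err; rewrite -normrN.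
apply: real_ler_norm; rewrite rpredN.
have -> : \sum_x w' x * v' x = #|free_normal S s|%:R - th * th' * #|K|%:R.
  by rewrite AE main addrC addKr.
by rewrite rpredB ?rpredM ?realn ?ger0_real.
Qed.

End Count.

(** * Irreducible factors of X^m - 1 *)

Section Factors.

Variable F : finFieldType.
Implicit Types (P Q D f g : {poly F}) (s : seq {poly F}).

Definition mirr f := irreducibleb f && (f \is monic).

Lemma mirr_irr f : mirr f -> irreducible_poly f.
Proof. by case/andP=> /irreducibleP. Qed.

Lemma mirr_size f : mirr f -> (1 < size f)%N.
Proof. by case/mirr_irr. Qed.

Lemma mirr_neq0 f : mirr f -> f != 0.
Proof. by move/mirr_irr/irredp_neq0. Qed.

Lemma mirr_coprime f D : mirr f -> coprimep f D = ~~ (f %| D).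
Proof. by move/mirr_irr/irreducible_poly_coprime. Qed.

Lemma mirr_coprime_neq f g : mirr f -> mirr g -> f != g -> coprimep f g.
Proof.
move=> mf mg; apply: contraNT; rewrite mirr_coprime // negbK => fg.
have [_ gI] := mirr_irr mg; have := gI f _ fg; rewrite eqp_monic.
- by apply; rewrite gtn_eqF // mirr_size.
- by case/andP: mf.
- by case/andP: mg.
Qed.

Lemma mirr_factor P : (1 < size P)%N -> exists2 f, mirr f & f %| P.
Proof.
have [n] := ubnP (size P); elim: n P => // n IHn P sPn sP.
have P0 : P != 0 by rewrite -size_poly_gt0 ltnW.
have [iP|] := boolP (irreducibleb P).
  exists ((lead_coef P)^-1 *: P); last first.
    by rewrite dvdpZl ?dvdpp // invr_eq0 lead_coef_eq0.
  have lc0 : (lead_coef P)^-1 != 0 by rewrite invr_eq0 lead_coef_eq0.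
  apply/andP; split; last by rewrite monicE lead_coefZ mulVf // lead_coef_eq0.
  have [_ PI] := irreducibleP _ iP; apply/irreducibleP; split=> [|D sD].
    by rewrite size_scale.
  rewrite dvdpZr // => /(PI D sD) DP.
  by apply: eqp_trans DP _; rewrite eqp_sym; apply: eqp_scale.
rewrite /irreducibleb sP /= negb_forall => /existsP[D].
rewrite negb_imply -Pdiv.Idomain.dvdpE -ltnNge => /andP[DP sD].
have sDP : (size D < size P)%N.
  by apply: leq_ltn_trans (size_npoly D) _; rewrite (ltn_predK sP).
have [|f mf fD] := IHn D _ sD; first exact: leq_trans sDP _.
by exists f => //; apply: dvdp_trans DP.
Qed.

Lemma mirr_factors P : P != 0 -> exists s, [/\ uniq s, all mirr s,
  all (fun f => f %| P) s &
  forall D, D %| P -> (1 < size D)%N -> exists2 f, f \in s & f %| D].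
Proof.
have [n] := ubnP (size P); elim: n P => // n IHn P sPn P0.
have [sP|sP] := leqP (size P) 1.
  by exists [::]; split=> // D /(dvdp_leq P0) sD; rewrite ltnNge (leq_trans sD).
have [f mf fP] := mirr_factor sP.
have PE : P = f * (P %/ f) by rewrite mulrC divpK.
have Q0 : P %/ f != 0 by apply: contraNneq P0 => Q0; rewrite PE Q0 mulr0.
have [|s [us ms ds sD]] := IHn (P %/ f) _ Q0.
  have sPE : size P = (size f + size (P %/ f)).-1.
    by rewrite {1}PE size_mul // mirr_neq0.
  have aux a b c : (1 < a -> c = (a + b).-1 -> c < n.+1 -> b < n)%N by lia.
  exact: aux (mirr_size mf) sPE sPn.
exists (undup (f :: s)); split; first exact: undup_uniq.
- by apply/allP=> g; rewrite mem_undup inE => /predU1P[->//|/(allP ms)].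
- apply/allP=> g; rewrite mem_undup inE => /predU1P[->//|/(allP ds) gQ].
  by rewrite PE dvdp_mull.
move=> D; rewrite {1}PE => DP sizeD.
have [fD|/negbTE] := boolP (f %| D); first by exists f; rewrite // mem_undup mem_head.
move/negbT; rewrite -mirr_coprime // coprimep_sym => /Gauss_dvdpr DQ.
rewrite DQ in DP; have [g gs gD] := sD D DP sizeD.
by exists g => //; rewrite mem_undup inE gs orbT.
Qed.

Lemma mirr_pairwise s : uniq s -> all mirr s -> pairwise (@coprimep F) s.
Proof.
elim: s => //= f s IHs /andP[fs us] /andP[mf ms]; rewrite IHs // andbT.
apply/allP=> g gs; apply: mirr_coprime_neq => //; first exact: (allP ms).
by apply: contraNneq fs => ->.
Qed.

Lemma sum_size_factors s Q : uniq s -> all mirr s -> all (fun f => f %| Q) s ->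
  Q != 0 -> (\sum_(f <- s) (size f).-1 <= (size Q).-1)%N.
Proof.
move=> us ms ds Q0; have cs := mirr_pairwise us ms.
have PQ : \prod_(f <- s) f %| Q.
  elim: s {us} ms ds cs => [|f s IHs] /=; first by rewrite big_nil dvd1p.
  move=> /andP[mf ms] /andP[df ds] /andP[cf cs]; rewrite big_cons.
  rewrite Gauss_dvdp ?df ?IHs //.
  elim: s cf {IHs ms ds cs} => [|g s IHs] /=; first by rewrite big_nil coprimep1.
  by rewrite big_cons coprimepMr => /andP[-> /IHs].
have -> : (\sum_(f <- s) (size f).-1)%N = (size (\prod_(f <- s) f)).-1.
  elim: s ms {us ds cs PQ} => [|f s IHs] /=; first by rewrite !big_nil size_poly1.
  move=> /andP[mf ms]; rewrite !big_cons IHs // size_mul ?(mirr_neq0 mf) //; last first.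
    by rewrite prodf_seq_neq0; apply/allP=> g /(allP ms)/mirr_neq0.
  have aux a b : (1 < a -> 0 < b -> a.-1 + b.-1 = (a + b).-1.-1)%N by lia.
  apply: aux (mirr_size mf) _.
  by rewrite size_poly_gt0 prodf_seq_neq0; apply/allP=> g /(allP ms)/mirr_neq0.
by rewrite -!subn1 leq_sub2r // dvdp_leq.
Qed.

Lemma size_Xn_subn1 n : (0 < n)%N -> size ('X^n - 1 : {poly F}) = n.+1.
Proof. by move=> n0; rewrite size_polyDl size_polyXn // size_polyN size_poly1. Qed.

Lemma Xn_sub1_neq0 n : (0 < n)%N -> 'X^n - 1 != 0 :> {poly F}.
Proof. by move=> n0; rewrite -size_poly_eq0 size_Xn_subn1. Qed.

(** Euclid's algorithm, run on the exponents by subtraction. *)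
Lemma dvdp_Xgcd f a b : f %| 'X^a - 1 -> f %| 'X^b - 1 -> f %| 'X^(gcdn a b) - 1.
Proof.
have [n] := ubnP (a + b)%N; elim: n a b => // n IHn a b abn fa fb.
wlog ab : a b abn fa fb / (a <= b)%N.
  case/orP: (leq_total a b) => ab; first exact.
  by rewrite gcdnC; apply; rewrite // addnC.
have [a0|a_gt0] := posnP a; first by rewrite a0 gcd0n.
rewrite -(subnKC ab) gcdnDl; apply: IHn => //; first by move: abn; lia.
have := dvdp_mull 'X^(b - a) fa; rewrite mulrBr mulr1 -exprD subnK // => h.
have -> : 'X^(b - a) - 1 = ('X^b - 1) - ('X^b - 'X^(b - a)) :> {poly F}.
  by rewrite opprB [RHS]addrC addrA subrK.
by rewrite dvdp_sub.
Qed.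

(** The class of X lies in a field with [#|F| ^ (size f).-1] elements, and X can be cancelled
    because a divisor of X^a - 1 is coprime to it. *)
Lemma mirr_dvd_Xq f a : mirr f -> (0 < a)%N -> f %| 'X^a - 1 ->
  f %| 'X^(#|F| ^ (size f).-1 - 1) - 1.
Proof.
move=> mf a_gt0 fa; have fI : monic_irreducible_poly f.
  by split; [exact: mirr_irr | case/andP: mf].
have q_gt0 : (0 < #|F| ^ (size f).-1)%N.
  by rewrite expn_gt0; apply/orP; left; apply/card_gt0P; exists 0.
pose x : {poly %/ f with fI} := in_qpoly f 'X.
have := expf_card x; rewrite card_qfpoly => xq.
have fX : coprimep f 'X.
  rewrite mirr_coprime //; apply/negP=> fX.
  have : f %| 1.
    rewrite -(dvdp_addr _ fa) subrK.
    by case: a a_gt0 fa => // a _ _; rewrite exprS dvdp_mulr.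
  by rewrite dvdp1 gtn_eqF // mirr_size.
have fXq : f %| 'X^(#|F| ^ (size f).-1) - 'X.
  have /(congr1 (fun p : {poly %/ f} => p : {poly F})) :
      in_qpoly f 'X ^+ (#|F| ^ (size f).-1) = in_qpoly f 'X by exact: xq.
  rewrite -rmorphXn /= mk_monicE // => /eqP.
  rewrite -!Pdiv.IdomainMonic.modpE; try by case/andP: mf.
  by rewrite -subr_eq0 -modpN -modpD => /eqP/modp_eq0P.
move: fXq; rewrite -{1}(subnK q_gt0) exprD expr1.
have -> : 'X^(#|F| ^ (size f).-1 - 1) * 'X - 'X = ('X^(#|F| ^ (size f).-1 - 1) - 1) * 'X :> {poly F}.
  by rewrite mulrBl mul1r.
by rewrite Gauss_dvdpl.
Qed.

Section Bounds.
Variables (m : nat) (s : seq {poly F}).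
Hypotheses (m_gt0 : (0 < m)%N) (us : uniq s) (ms : all mirr s).
Hypothesis ds : all (fun f => f %| 'X^m - 1) s.
Hypothesis co : coprime m (#|F| - 1).

Let cnt d := count (fun f : {poly F} => size f == d.+1) s.

Let dvd_gcd f d : f \in s -> size f == d.+1 ->
  f %| 'X^(gcdn m (#|F| ^ d - 1)) - 1.
Proof.
move=> fs /eqP sf; apply: dvdp_Xgcd; first exact: (allP ds).
have := mirr_dvd_Xq (allP ms _ fs) m_gt0 (allP ds _ fs).
by rewrite sf.
Qed.

Let sum_cnt d : (\sum_(f <- [seq f : {poly F} <- s | size f == d.+1]) (size f).-1 = d * cnt d)%N.
Proof.
rewrite big_filter (eq_bigr (fun=> d)) => [|f /eqP-> //].
by rewrite big_const_seq iter_addn_0 mulnC.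
Qed.

Lemma count_linear : (cnt 1 <= 1)%N.
Proof.
have := @sum_size_factors [seq f : {poly F} <- s | size f == 2%N]
  ('X^(gcdn m (#|F| ^ 1 - 1)) - 1).
rewrite sum_cnt mul1n expn1 (eqP co) size_Xn_subn1 //; apply.
- exact: filter_uniq.
- by apply/allP=> f; rewrite mem_filter => /andP[_ /(allP ms)].
- apply/allP=> f; rewrite mem_filter => /andP[sf fs].
  by have := dvd_gcd fs sf; rewrite expn1 (eqP co).
- exact: Xn_sub1_neq0.
Qed.

(** The factors of degree [d] divide X^g - 1. So does X - 1, which is not one of them: hence the
    subtracted 1. *)
Lemma count_degree d : (1 < d)%N ->
  (cnt d <= (gcdn m (#|F| ^ d - 1) - 1) %/ d)%N.
Proof.
move=> d1; pose g := gcdn m (#|F| ^ d - 1).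
have g_gt0 : (0 < g)%N by rewrite gcdn_gt0 m_gt0.
have X1E : 'X - 1 = 'X - 1%:P :> {poly F} by rewrite polyC1.
have mX1 : mirr ('X - 1).
  by apply/andP; split; rewrite X1E ?monicXsubC //; apply/irreducibleP/irredp_XsubC.
have := @sum_size_factors (('X - 1) :: [seq f : {poly F} <- s | size f == d.+1]) ('X^g - 1).
rewrite big_cons sum_cnt X1E size_XsubC size_Xn_subn1 // -X1E /= => H.
rewrite leq_divRL ?(ltnW d1) // mulnC -/g leq_subRL // add1n -add1n; apply: H.
- rewrite filter_uniq // andbT mem_filter X1E size_XsubC.
  by apply/negP=> /andP[/eqP]; lia.
- rewrite mX1 /=; apply/allP=> f; rewrite mem_filter => /andP[_ /(allP ms)//].
- rewrite X1E dvdp_XsubCl rootE !hornerE expr1n subrr eqxx /=.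
  by apply/allP=> f; rewrite mem_filter => /andP[sf fs]; apply: dvd_gcd.
- exact: Xn_sub1_neq0.
Qed.

(** X^m - 1 is the [e]-th power of X^m' - 1, so both have the same irreducible factors. *)
Lemma sum_degrees m' e : m = (m' * e)%N -> [pchar F].-nat e ->
  (\sum_(f <- s) (size f).-1 <= m')%N.
Proof.
move=> mE eF; have m'_gt0 : (0 < m')%N by move: m_gt0; rewrite mE muln_gt0 => /andP[].
have e_gt0 : (0 < e)%N by move: m_gt0; rewrite mE muln_gt0 => /andP[].
have := @sum_size_factors s ('X^m' - 1) us ms; rewrite size_Xn_subn1 //; apply.
  apply/allP=> f fs; have := allP ds _ fs; have mf := allP ms _ fs.
  have -> : 'X^m - 1 = ('X^m' - 1) ^+ e :> {poly F}.
    have eP : [pchar {poly F}].-nat e by rewrite (eq_pnat _ (pchar_poly F)).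
    by rewrite exprDn_pchar // exprNn_pchar // expr1n -exprM mE.
  by apply: contraTT; rewrite -!mirr_coprime // coprimep_pexpr.
exact: Xn_sub1_neq0.
Qed.

Lemma size_le2 : (2 * size s <= m + 1)%N.
Proof.
have sd : (\sum_(f <- s) (size f).-1 <= m)%N by apply: (@sum_degrees m 1); rewrite ?muln1.
apply: leq_trans (leq_add sd count_linear).
rewrite /cnt -sum1_size big_distrr /= -sum1_count [X in (_ + X)%N]big_mkcond /=.
rewrite -big_split /= big_seq [leqRHS]big_seq; apply: leq_sum => f fs.
have aux a : (1 < a -> 2 * 1 <= a.-1 + (if a == 2 then 1 else 0))%N.
  by case: eqP; lia.
exact: aux (mirr_size (allP ms _ fs)).
Qed.

(** A factor of degree d < 5 falls short of weight 5 by 5 - d; these deficits, at most 4 in all for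
    d = 1, are added back. *)
Lemma size_le5 m' e : m = (m' * e)%N -> [pchar F].-nat e ->
  (5 * size s <= m' + 4 + 3 * ((gcdn m (#|F| ^ 2 - 1) - 1) %/ 2)
     + 2 * ((gcdn m (#|F| ^ 3 - 1) - 1) %/ 3)
     + (gcdn m (#|F| ^ 4 - 1) - 1) %/ 4)%N.
Proof.
move=> mE eF; have sd := sum_degrees mE eF; have c1 := count_linear.
have c2 := count_degree (isT : 1 < 2)%N.
have c3 := count_degree (isT : 1 < 3)%N.
have c4 := count_degree (isT : 1 < 4)%N.
apply: (@leq_trans (\sum_(f <- s) (size f).-1 + 4 * cnt 1 + 3 * cnt 2 + 2 * cnt 3 + cnt 4)).
  have aux a S n k1 k2 k3 k4 : (1 < a ->
      5 * n <= S + 4 * k1 + 3 * k2 + 2 * k3 + k4 ->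
      5 * n.+1 <= (a.-1 + S) + 4 * ((a == 2) + k1) + 3 * ((a == 3) + k2) +
        2 * ((a == 4) + k3) + ((a == 5) + k4))%N.
    by do 4![case: eqP]; rewrite /=; lia.
  rewrite /cnt; elim: s ms => [|f r IHr] /=; first by rewrite big_nil.
  by move=> /andP[mf /IHr IH]; rewrite big_cons; apply: aux (mirr_size mf) IH.
by move: sd c1 c2 c3 c4; lia.
Qed.

End Bounds.

End Factors.

(** * Prime divisors of the order *)

Local Close Scope ring_scope.

Lemma prod_primes_leq n : 0 < n -> \prod_(p <- primes n) p <= n.
Proof.
move=> n_gt0; rewrite [X in _ <= X](prod_prime_decomp n_gt0).
rewrite /primes big_map big_seq [X in _ <= X]big_seq; apply: leq_prod => -[p e].
by move/mem_prime_decomp=> [pr_p e_gt0 _] /=; rewrite -{1}(expn1 p) leq_pexp2l // prime_gt0.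
Qed.

Definition primes32 := [:: 2; 3; 5; 7; 11; 13; 17; 19; 23; 29; 31].

Lemma mem_primes32 p : prime p -> p < 32 -> p \in primes32.
Proof.
move=> pr_p p32; have : all (fun p => prime p ==> (p \in primes32)) (iota 0 32) by [].
by move/allP/(_ p); rewrite mem_iota pr_p; apply.
Qed.

Lemma omega_leq n : 0 < n -> let s := [seq p <- primes32 | p %| n] in
  size s <= size (primes n) /\
  32 ^ (size (primes n) - size s) * \prod_(p <- s) p <= n.
Proof.
move=> n_gt0 s; pose a := [seq p <- primes n | p < 32].
pose b := [seq p <- primes n | ~~ (p < 32)].
have pab : perm_eq (primes n) (a ++ b) by rewrite perm_sym perm_filterC.
have psa : perm_eq s a.
  apply: uniq_perm; rewrite ?filter_uniq ?primes_uniq // => p.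
  rewrite !mem_filter mem_primes n_gt0 /=; have [pn|] := boolP (p %| n); last by rewrite !andbF.
  rewrite andbT /=; apply/idP/andP => [p32|[]]; last by move=> ? ?; apply: mem_primes32.
  have : all (fun p => (p < 32) && prime p) primes32 by [].
  by move/allP/(_ p p32)/andP=> [].
have sE : size (primes n) = size s + size b.
  by rewrite (perm_size pab) size_cat (perm_size psa).
rewrite sE leq_addr addKn; split=> //; apply: leq_trans (prod_primes_leq n_gt0).
rewrite (perm_big _ pab) big_cat /= (perm_big _ psa) mulnC leq_mul2l /=; apply/orP; right.
have : all (fun p => 32 <= p) b.
  by apply/allP=> p; rewrite mem_filter -leqNgt => /andP[].
elim: (b) => [|p r IHr] /=; first by rewrite !big_nil.
by move=> /andP[p32 /IHr]; rewrite !big_cons expnS; apply: leq_mul.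
Qed.

(** Dropping an entry of [l] trades it for a factor 32, which is no smaller. So the worst case of
    [omega_exp] is that all of [primes32] divide [n]. *)
Lemma leq_filter_prod (P : pred nat) (l : seq nat) : all (fun p => p <= 32) l ->
  \prod_(p <- l) p * 32 ^ size [seq p <- l | P p] <=
  32 ^ size l * \prod_(p <- [seq p <- l | P p]) p.
Proof.
elim: l => [|p l IHl] /=; first by rewrite !big_nil.
move=> /andP[p32 /IHl IH]; rewrite big_cons; case: (P p) => /=.
  rewrite big_cons !expnS mulnACA [p * 32]mulnC [X in _ <= X]mulnACA.
  by rewrite leq_mul2l IH orbT.
by rewrite expnS -!mulnA leq_mul.
Qed.

Lemma omega_exp n : 0 < n -> 2 ^ (5 * size (primes n)) <= 2 ^ 18 * n.
Proof.
move=> n_gt0; have [] := omega_leq n_gt0; set s := [seq p <- _ | _].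
set w := size (primes n) => sw wn.
(* There are eleven primes below 32, and 32^11 / 2^37 = 2^18 is the constant of the statement. *)
have M37 : 2 ^ 37 <= \prod_(p <- primes32) p.
  by rewrite /primes32 !big_cons big_nil; lia.
have le_s := @leq_filter_prod (fun p => p %| n) primes32 isT.
rewrite -/s [size primes32]/= in le_s.
have le_w : (\prod_(p <- primes32) p) * 32 ^ w <= 32 ^ 11 * n.
  rewrite -(subnK sw) expnD mulnCA mulnC.
  apply: leq_trans (leq_mul le_s (leqnn _)) _.
  by rewrite -mulnA leq_mul2l mulnC wn orbT.
have e32 : 2 ^ 5 = 32 by [].
rewrite expnM e32.
have := leq_trans (leq_mul M37 (leqnn (32 ^ w))) le_w.
by move: (32 ^ w) => A; clear; lia.
Qed.

(** * The numerical inequality *)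

(** After taking fifth powers, w enters through the square of [2 ^ (5 * w)], at most (c n)^2. As n
    (q - 1) is below q^m, this uses up q^(2m) out of q^(5m), and the last hypothesis says that the
    rest suffices for r. *)
Lemma sieve_tail q m w r n c : 1 < q -> n * (q - 1) < q ^ m ->
    2 ^ (5 * w) <= c * n -> c ^ 2 * 2 ^ (10 * r) <= q ^ (3 * m) * (q - 1) ^ 2 ->
  ((2 ^ w - 1) * (2 ^ r - 1)) ^ 2 < q ^ m.
Proof.
move=> q_gt1 nq wn rq.
have pw2 k : 0 < 2 ^ k by rewrite expn_gt0.
have lt2 : (2 ^ w - 1) * (2 ^ r - 1) < 2 ^ w * 2 ^ r.
  apply: (@leq_ltn_trans ((2 ^ w - 1) * 2 ^ r)); first by rewrite leq_mul2l leq_subr orbT.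
  by rewrite ltn_mul2r pw2 ltn_subrL pw2.
apply: (@leq_trans ((2 ^ w * 2 ^ r) ^ 2)); first by rewrite ltn_exp2r.
have q1 : 0 < (q - 1) ^ 2 by rewrite expn_gt0 subn_gt0 q_gt1.
rewrite -(leq_exp2r _ _ (isT : 0 < 5)) -(leq_pmul2r q1).
have -> : ((2 ^ w * 2 ^ r) ^ 2) ^ 5 = (2 ^ (5 * w)) ^ 2 * 2 ^ (10 * r).
  rewrite -!expnD -!expnM -expnD; congr (2 ^ _); lia.
have -> : (q ^ m) ^ 5 * (q - 1) ^ 2 = q ^ (3 * m) * (q - 1) ^ 2 * (q ^ m) ^ 2.
  rewrite mulnAC -!expnM -expnD; congr (q ^ _ * _); lia.
apply: (@leq_trans ((c * n) ^ 2 * 2 ^ (10 * r) * (q - 1) ^ 2)).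
  by rewrite !leq_mul2r leq_exp2r // wn !orbT.
have -> : (c * n) ^ 2 * 2 ^ (10 * r) * (q - 1) ^ 2 =
    c ^ 2 * 2 ^ (10 * r) * (n * (q - 1)) ^ 2.
  rewrite !(expnMn _ _ 2) -!mulnA; congr (_ * _).
  by rewrite !(mulnCA n (2 ^ _)).
by rewrite leq_mul // leq_exp2r // ltnW.
Qed.

(* The analytic bound settles the case [table_bound q <= m], computation the other
   one; in particular nothing is left to compute for [128 <= q]. *)
Definition table_bound q :=
  if q < 4 then 70 else if q < 8 then 41 else if q < 16 then 11 else
  if q < 32 then 6 else if q < 64 then 4 else if q < 128 then 3 else 2.

Definition degree_bound q m (m' : nat) :=
  m' + 4 + 3 * ((gcdn m (q ^ 2 - 1) - 1) %/ 2)
     + 2 * ((gcdn m (q ^ 3 - 1) - 1) %/ 3) + (gcdn m (q ^ 4 - 1) - 1) %/ 4.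

Lemma pow2_leq k q m : 0 < k -> 2 ^ k <= q ->
  2 ^ (3 * k * m + 2 * (k - 1)) <= q ^ (3 * m) * (q - 1) ^ 2.
Proof.
move=> k_gt0 kq; rewrite expnD; apply: leq_mul.
  have [->|m_gt0] := posnP m; first by rewrite !muln0.
  have -> : 3 * k * m = k * (3 * m) by lia.
  by rewrite expnM leq_exp2r // muln_gt0.
rewrite mulnC expnM leq_exp2r //; apply: leq_trans (leq_sub2r 1 kq).
have -> : 2 ^ k = 2 * 2 ^ (k - 1) by rewrite -expnS subn1 prednK.
have : 0 < 2 ^ (k - 1) by rewrite expn_gt0.
by move: (2 ^ (k - 1)) => x; lia.
Qed.

Lemma sieve_large q m w r n : 1 < q -> 1 < m -> table_bound q <= m ->
    n * (q - 1) < q ^ m -> 2 ^ (5 * w) <= 2 ^ 18 * n ->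
    2 * r <= m + 1 -> 5 * r <= degree_bound q m m ->
  ((2 ^ w - 1) * (2 ^ r - 1)) ^ 2 < q ^ m.
Proof.
move=> q_gt1 m_gt1 tm nq wn r2 r5; apply: sieve_tail nq wn _ => //.
rewrite -expnM -expnD; move: tm; rewrite /table_bound.
(* As 2 r <= m + 1, the exponent [18 * 2 + 10 * r] is at most [41 + 5 * m]. For large [m] the
   condition on [k] amounts to 3 k > 5. *)
have big k : 0 < k -> 2 ^ k <= q -> 41 + 5 * m <= 3 * k * m + 2 * (k - 1) ->
    2 ^ (18 * 2 + 10 * r) <= q ^ (3 * m) * (q - 1) ^ 2.
  move=> k_gt0 kq km; apply: leq_trans (pow2_leq m k_gt0 kq).
  by rewrite leq_exp2l //; lia.
have gle a : 0 < a -> gcdn m a <= a by move=> a0; rewrite dvdn_leq // dvdn_gcdr.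
case: (ltnP q 4) => q4.
  (* Here k = 1, and [5 * m] is too much. The other bound on [r] gives 10 r <= 2 m plus a constant,
     each gcd being at most q^d - 1. *)
  move=> m70; have [q2|q3] : q = 2 \/ q = 3 by lia.
    subst q; have := gle (2 ^ 2 - 1) isT; have := gle (2 ^ 3 - 1) isT.
    have := gle (2 ^ 4 - 1) isT; move: r5; rewrite /degree_bound.
    move: (gcdn _ _) (gcdn _ _) (gcdn _ _) => g4 g3 g2 r5 h2 h3 h4.
    by rewrite muln1 leq_exp2l //; lia.
  subst q; have := gle (3 ^ 2 - 1) isT; have := gle (3 ^ 3 - 1) isT.
  have := gle (3 ^ 4 - 1) isT; move: r5; rewrite /degree_bound.
  move: (gcdn _ _) (gcdn _ _) (gcdn _ _) => g4 g3 g2 r5 h2 h3 h4.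
  apply: (@leq_trans (2 ^ (4 * m) * 2 ^ 2)).
    by rewrite -expnD leq_exp2l //; lia.
  by rewrite leq_mul2r !expnM leq_exp2r ?orbT //; lia.
case: (ltnP q 8) => q8; first by move=> h; apply: (big 2) => //; lia.
case: (ltnP q 16) => q16; first by move=> h; apply: (big 3) => //; lia.
case: (ltnP q 32) => q32; first by move=> h; apply: (big 4) => //; lia.
case: (ltnP q 64) => q64; first by move=> h; apply: (big 5) => //; lia.
case: (ltnP q 128) => q128; first by move=> h; apply: (big 6) => //; lia.
by move=> h; apply: (big 7) => //; lia.
Qed.

(** * Verification of the finitely many small cases *)

Section Table.

Import BinNat Nnat.

(** Reducing at every step keeps unary numbers small here and in the next two definitions; in
    [gcdmod], adding [m.-1] subtracts 1 modulo [m]. *)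
Definition expmod q d m := iter d (fun y => (y * q) %% m) (1 %% m).
Definition geomod q m p := iter m (fun y => (y * q + 1) %% p) 0.
Definition gcdmod q d m := gcdn m (expmod q d m + m.-1).

Lemma expmodE q d m : expmod q d m = q ^ d %% m.
Proof. by elim: d => [|d IHd] //=; rewrite IHd modnMml expnSr. Qed.

Lemma geomodE q m p : geomod q m p = (\sum_(i < m) q ^ i) %% p.
Proof.
elim: m => [|m IHm] /=; first by rewrite big_ord0 mod0n.
rewrite /geomod in IHm *; rewrite /= IHm -modnDml modnMml modnDml big_ord_recl.
rewrite addnC big_distrl /=; congr ((_ + _) %% _).
by apply: eq_bigr => i _; rewrite expnSr.
Qed.

Lemma gcdmodE q d m : 0 < q -> 0 < m -> gcdmod q d m = gcdn m (q ^ d - 1).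
Proof.
move=> q_gt0 m_gt0; rewrite /gcdmod expmodE -gcdn_modr modnDml gcdn_modr.
have -> : q ^ d + m.-1 = (q ^ d - 1) + m.
  by have : 0 < q ^ d by [rewrite expn_gt0 q_gt0]; move: (q ^ d) => x; lia.
by rewrite gcdnDr.
Qed.

Lemma of_nat_exp a b : N.of_nat (a ^ b) = N.pow (N.of_nat a) (N.of_nat b).
Proof.
elim: b => [|b IHb]; first by rewrite expn0.
by rewrite expnS Nat2N.inj_succ N.pow_succ_r' -IHb -Nat2N.inj_mul.
Qed.

Lemma leq_of_nat a b : N.leb (N.of_nat a) (N.of_nat b) -> a <= b.
Proof. by move/N.leb_spec0; lia. Qed.

Lemma ltn_of_nat a b : N.ltb (N.of_nat a) (N.of_nat b) -> a < b.
Proof. by move/N.ltb_spec0; lia. Qed.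

(* [s], of which [d] is the product times [q - 1], lists the prime divisors below
   [32] of [n]; the other ones number at most [t]. Binary arithmetic keeps the
   computation feasible. *)
Definition table_check q m :=
  let r := (m %/ gcdn m (expmod q 6 m) + 4 + 3 * ((gcdmod q 2 m - 1) %/ 2)
     + 2 * ((gcdmod q 3 m - 1) %/ 3) + (gcdmod q 4 m - 1) %/ 4) %/ 5 in
  let s := [seq p <- primes32 | geomod q m p == 0] in
  let Q := N.pow (N.of_nat q) (N.of_nat m) in
  let d := N.mul (foldr (fun p a => N.mul (N.of_nat p) a) 1%num s) (N.of_nat (q - 1)) in
  let t := N.to_nat (N.div (N.log2 (N.div Q d)) 5%num) in
  N.leb Q (N.mul (N.pow (N.of_nat 32) (N.of_nat t.+1)) d) &&
  N.ltb (N.pow (N.mul (N.sub (N.pow (N.of_nat 2) (N.of_nat (size s + t))) 1%num)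
                      (N.sub (N.pow (N.of_nat 2) (N.of_nat r)) 1%num)) (N.of_nat 2)) Q.

Definition table_exception q m := (q == 2) && (m \in [:: 3; 6; 15]).

(** Every integer [q] from 2 to 127 is tried, prime power or not. *)
Lemma table_checked : all (fun q => all (fun m =>
    [|| ~~ coprime m (q - 1), table_exception q m | table_check q m])
  (iota 2 (table_bound q - 2))) (iota 2 126).
Proof. by vm_compute. Qed.

Lemma table_sound q m w r n : 1 < q -> 1 < m -> table_check q m ->
    n = \sum_(i < m) q ^ i -> n * (q - 1) < q ^ m -> w = size (primes n) ->
    5 * r <= degree_bound q m (m %/ gcdn m (q ^ 6)) ->
  ((2 ^ w - 1) * (2 ^ r - 1)) ^ 2 < q ^ m.
Proof.
move=> q_gt1 m_gt1 + nE nq wE r5; rewrite /table_check.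
have q_gt0 := ltnW q_gt1; have m_gt0 := ltnW m_gt1.
rewrite expmodE gcdn_modr !gcdmodE //; set r' := _ %/ 5.
have rr' : r <= r' by rewrite /r' leq_divRL // mulnC.
set s := [seq p <- _ | _]; set d := N.mul (foldr _ _ _) _; set t := N.to_nat _.
have sE : s = [seq p <- primes32 | p %| n].
  by apply: eq_filter => p; rewrite geomodE -nE /dvdn.
have dE : d = N.of_nat ((\prod_(p <- s) p) * (q - 1)).
  rewrite Nat2N.inj_mul /d; congr (N.mul _ _).
  elim: (s) => [|p l IHl] /=; first by rewrite big_nil.
  by rewrite big_cons Nat2N.inj_mul IHl.
rewrite dE -!of_nat_exp -Nat2N.inj_mul => /andP[/leq_of_nat h1].
rewrite (_ : 1%num = N.of_nat 1) // -!Nat2N.inj_sub -Nat2N.inj_mul -of_nat_exp.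
move/ltn_of_nat; apply: leq_ltn_trans.
have n_gt0 : 0 < n.
  by rewrite nE -(prednK m_gt0) big_ord_recl expn0.
have [sw wn] := omega_leq n_gt0; rewrite -sE -wE in sw wn.
have ws : w <= size s + t.
  (* One more large prime would contradict the first test of the table. That test certifies [t], so
     the logarithm that produced it needs no analysis. *)
  rewrite leqNgt; apply/negP=> tw.
  have : 32 ^ t.+1 * \prod_(p <- s) p * (q - 1) < q ^ m.
    apply: leq_ltn_trans nq; rewrite leq_mul2r; apply/orP; right.
    by apply: leq_trans wn; rewrite leq_mul2r leq_exp2l // ?orbT //; lia.
  by rewrite -mulnA ltnNge h1.
rewrite leq_exp2r // leq_mul // leq_sub2r // leq_exp2l //.
Qed.

Lemma sieve_numeric q m w r n : 1 < q -> 1 < m -> coprime m (q - 1) ->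
    ~~ table_exception q m ->
    n = \sum_(i < m) q ^ i -> n * (q - 1) < q ^ m -> w = size (primes n) ->
    2 * r <= m + 1 -> 5 * r <= degree_bound q m (m %/ gcdn m (q ^ 6)) ->
  ((2 ^ w - 1) * (2 ^ r - 1)) ^ 2 < q ^ m.
Proof.
move=> q_gt1 m_gt1 co ex nE nq wE r2 r5.
have [bm|mb] := leqP (table_bound q) m.
  have n_gt0 : 0 < n by rewrite nE -(prednK (ltnW m_gt1)) big_ord_recl expn0.
  apply: (sieve_large q_gt1 m_gt1 bm nq _ r2); first by rewrite wE omega_exp.
  apply: leq_trans r5 _; rewrite /degree_bound !leq_add2r.
  exact: leq_div.
have q128 : q < 128.
  rewrite ltnNge; apply/negP=> q128; move: mb; rewrite /table_bound.
  have qF k : k <= 128 -> (q < k) = false by lia.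
  by rewrite !qF // ltnNge m_gt1.
apply: (table_sound q_gt1 m_gt1 _ nE nq wE r5).
have /allP/(_ q) := table_checked; rewrite mem_iota => /(_ _)/allP/(_ m).
rewrite mem_iota co (negPf ex) /=; apply; last by lia.
by lia.
Qed.

End Table.

(** * Existence of free normal elements *)

Local Open Scope ring_scope.

Lemma pred_add_gt1 k a b : (k.+1 = (a + b).-1 -> b <= k -> 1 < a)%N.
Proof. by lia. Qed.

Section Existence.

Variables (F K : finFieldType) (iota : {rmorphism F -> K}) (m : nat).
Let q := #|F|.
Hypotheses (m_gt1 : (1 < m)%N) (cardK : #|K| = (q ^ m)%N).

Let m_gt0 : (0 < m)%N. Proof. exact: ltnW. Qed.
Let q_gt1 : (1 < q)%N. Proof. exact: finNzRing_gt1. Qed.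
Let n := #|K|.-1.
Let N := (\sum_(i < m) q ^ i)%N.

Lemma card_unit_factor : n = (N * (q - 1))%N.
Proof. by rewrite /n cardK predn_exp mulnC subn1. Qed.

Let n_gt0 : (0 < n)%N. Proof. by rewrite /n -subn1 subn_gt0 finNzRing_gt1. Qed.
Let N_gt0 : (0 < N)%N.
Proof. by move: n_gt0; rewrite card_unit_factor muln_gt0 => /andP[]. Qed.

Let frobMq P Q (x : K) : frob iota q (P * Q) x = frob iota q P (frob iota q Q x).
Proof. by have := frobM iota 1 P Q x; rewrite expn1. Qed.

Let frob0q P : frob iota q P 0 = 0 :> K.
Proof. by have := frob0r iota 1 P; rewrite expn1. Qed.

Lemma frob_Xm_sub1 (x : K) : frob iota q ('X^m - 1) x = 0.
Proof.
rewrite frobDl -polyC1 -polyCN frobC rmorphN rmorph1 mulN1r.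
rewrite (@frobE _ _ _ _ _ _ m.+1) ?size_polyXn // big_ord_recr /= coefXn eqxx.
rewrite rmorph1 mul1r big1 ?add0r => [|i _]; last first.
  by rewrite coefXn ltn_eqF // rmorph0 mul0r.
by rewrite -cardK expf_card subrr.
Qed.

Variable s : seq {poly F}.
Hypotheses (us : uniq s) (ms : all (@mirr F) s).
Hypothesis ds : all (fun f : {poly F} => f %| 'X^m - 1) s.
Hypothesis cover : forall D, D %| 'X^m - 1 -> (1 < size D)%N ->
  exists2 f, f \in s & f %| D.

Let s_neq0 : s != [::].
Proof.
have [|f] := cover (dvdpp _); first by rewrite size_Xn_subn1.
by case: (s).
Qed.

Let rel_prime_s : pairwise (@coprimep F) s := mirr_pairwise us ms.

Definition full_free (x : K) :=
  (forall l, prime l -> (l %| N)%N -> x ^+ (n %/ l) != 1) /\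
  (forall P : {poly F}, P != 0 -> (size P <= m)%N -> frob iota q P x != 0).

(** If [P] kills [x], so does its gcd [D] with X^m - 1. The quotient [H] is not constant, so some
    [f] of [s] divides it; then [cof m f] is a multiple of [D] and kills [x], which was excluded. *)
Lemma free_normalP S R x : {subset primes N <= S ++ R} ->
    x \in free_normal iota m S s -> all (fun l => x ^+ (n %/ l) != 1) R ->
  full_free x.
Proof.
move=> NS; rewrite inE => /and3P[x0 xS xs] xR; split=> [l pl lN|P P0 sP].
  have : l \in S ++ R by apply: NS; rewrite mem_primes pl N_gt0.
  by rewrite mem_cat => /orP[/(allP xS)|/(allP xR)].
apply/eqP=> Px; have X0 := @Xn_sub1_neq0 F _ m_gt0.
pose D := gcdp P ('X^m - 1); have Dm : D %| 'X^m - 1 by apply: dvdp_gcdr.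
have D0 : D != 0 by rewrite gcdp_eq0 negb_and P0.
have frob_eqp A B : A %= B -> frob iota q A x = 0 -> frob iota q B x = 0.
  case/eqpP=> -[a b] /= /andP[a0 b0] AB A0.
  have := congr1 (fun C => frob iota q C x) AB.
  rewrite -!mul_polyC !frobMq A0 !frobC mulr0 => /esym/eqP.
  by rewrite mulf_eq0 fmorph_eq0 (negPf b0) => /eqP.
have Dx : frob iota q D x = 0.
  have [[u v] /= /frob_eqp] := Bezoutp P ('X^m - 1); apply.
  by rewrite frobDl !frobMq Px frob_Xm_sub1 !frob0q addr0.
have sD : (size D <= m)%N by apply: leq_trans sP; apply: dvdp_leq (dvdp_gcdl _ _).
have [H HD] : exists H, 'X^m - 1 = H * D by exists (('X^m - 1) %/ D); rewrite divpK.
clearbody D; have H0 : H != 0 by apply: contraNneq X0 => H0; rewrite HD H0 mul0r.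
have sH : (1 < size H)%N.
  have sHD : size ('X^m - 1 : {poly F}) = (size H + size D).-1.
    by rewrite HD size_mul.
  rewrite size_Xn_subn1 // in sHD.
  exact: pred_add_gt1 sHD sD.
have [|f fs fH] := cover _ sH; first by rewrite HD dvdp_mulr.
have : cof m f = (H %/ f) * D.
  have f0 := mirr_neq0 (allP ms _ fs).
  by rewrite /cof HD -{1}(divpK fH) [_ * f * D]mulrAC mulpK.
have /eqP := allP xs _ fs; rewrite -/q => fx fE; case: fx.
by rewrite fE frobMq Dx frob0q.
Qed.

(** For each prime l of [R], at most n / l elements satisfy x^(n/l) = 1; these are simply
    subtracted. *)
Lemma full_free_sieve S R : {subset primes N <= S ++ R} ->
    all (dvdn^~ n) R ->
    (\sum_(l <- R) n %/ l < #|free_normal iota m S s|)%N ->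
  exists2 x, x != 0 & full_free x.
Proof.
move=> NS Rn lt_card.
pose B := [set x : K | has (fun l => x ^+ (n %/ l) == 1) R].
have cardB : (#|B| <= \sum_(l <- R) n %/ l)%N.
  elim: R Rn @B {NS lt_card} => [|l R IHR] /=.
    by rewrite big_nil leqn0 cards_eq0 => _; apply/eqP/setP=> x; rewrite !inE.
  move=> /andP[ln /IHR IH]; rewrite big_cons.
  rewrite (_ : [set x | _] = [set x : K | x ^+ (n %/ l) == 1] :|:
    [set x : K | has (fun l => x ^+ (n %/ l) == 1) R]); last first.
    by apply/setP=> x; rewrite !inE.
  apply: leq_trans (leq_card_setU _ _) _; apply: leq_add => //.
  rewrite cardE; apply: max_unity_roots; last exact: enum_uniq.
    by rewrite divn_gt0 ?(dvdn_gt0 n_gt0 ln) // dvdn_leq.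
  by apply/allP=> x; rewrite mem_enum inE unity_rootE.
have /subsetPn[x xA xB] : ~~ (free_normal iota m S s \subset B).
  by apply: contraL lt_card => /subset_leq_card AB; rewrite -leqNgt (leq_trans AB).
exists x; first by move: xA; rewrite inE => /andP[].
apply: (free_normalP NS xA); apply: contraNT xB.
rewrite -has_predC inE => /hasP[l lR /= xl]; apply/hasP; exists l => //.
by rewrite negbK in xl.
Qed.

Let r := size s.

Lemma card_free_normal_lower S (a b c : algC) :
    uniq S -> all prime S -> all (dvdn^~ n) S -> 0 <= a -> 0 <= b -> 0 <= c ->
    a <= \prod_(l <- S) (1 - l%:R^-1) ->
    b <= \prod_(f <- s) (1 - (q ^ (size f).-1)%:R^-1) ->
    c <= #|K|%:R - (2%:R ^+ size S - 1) * (2%:R ^+ r - 1) * sqrtC #|K|%:R ->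
  a * b * c <= #|free_normal iota m S s|%:R.
Proof.
move=> uS pS dS a0 b0 c0 aS bs cX.
have [chi chiP] := mult_pairing_exists K.
apply: le_trans (card_free_normal iota m_gt0 cardK chiP uS pS dS rel_prime_s ds s_neq0).
have inv_le (k l : nat) : (0 < k)%N -> (k <= l)%N -> 1 - k%:R^-1 <= 1 - l%:R^-1 :> algC.
  move=> k0 kl; rewrite lerD2l lerN2 lef_pV2 ?posrE ?ltr0n ?ler_nat //.
  exact: leq_trans kl.
have frac_ge0 (k : nat) : 0 <= 1 - k%:R^-1 :> algC.
  rewrite subr_ge0; case: k => [|k]; rewrite ?invr0 ?ler01 //.
  by rewrite invf_le1 ?ler1n ?ltr0n.
apply: ler_pM => //; first exact: mulr_ge0.
apply: ler_pM => //.
  apply: le_trans aS _; rewrite big_seq [leRHS]big_seq.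
  apply: ler_prod => l lS; rewrite frac_ge0 inv_le ?(prime_gt0 (allP pS _ lS)) //.
  by apply: (leq_card_powers chiP); apply: (allP dS).
apply: le_trans bs _; rewrite big_seq [leRHS]big_seq.
apply: ler_prod => f fs; rewrite frac_ge0 inv_le ?expn_gt0 ?(ltnW q_gt1) //.
exact: (leq_card_coker iota m_gt0 cardK (allP ds _ fs)).
Qed.

Lemma full_free_generic :
    (((2 ^ size (primes N) - 1) * (2 ^ r - 1)) ^ 2 < q ^ m)%N ->
  exists2 x, x != 0 & full_free x.
Proof.
move=> lt_q; apply: (@full_free_sieve (primes N) [::]) => //.
  by move=> l; rewrite cats0.
rewrite big_nil -(ltr0n algC).
have frac_gt0 (k : nat) : (1 < k)%N -> 0 < 1 - k%:R^-1 :> algC.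
  by move=> k1; rewrite subr_gt0 invf_lt1 ?ltr1n ?ltr0n // ltnW.
pose a : algC := \prod_(l <- primes N) (1 - l%:R^-1).
pose b : algC := \prod_(f <- s) (1 - (q ^ (size f).-1)%:R^-1).
pose c : algC := #|K|%:R - (2%:R ^+ size (primes N) - 1) * (2%:R ^+ r - 1) * sqrtC #|K|%:R.
have a0 : 0 < a.
  rewrite /a big_seq; apply: prodr_gt0 => l; rewrite mem_primes => /andP[pl _].
  exact/frac_gt0/prime_gt1.
have b0 : 0 < b.
  rewrite /b big_seq; apply: prodr_gt0 => f fs; apply: frac_gt0.
  rewrite -(expn0 q) ltn_exp2l // -subn1 subn_gt0.
  exact: mirr_size (allP ms _ fs).
have c0 : 0 < c.
  rewrite /c subr_gt0 -[ltRHS]sqrtCK expr2 ltr_pM2r ?sqrtC_gt0 ?ltr0n; last first.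
    by apply/card_gt0P; exists 0.
  have -> : (2%:R ^+ size (primes N) - 1) * (2%:R ^+ r - 1) =
      ((2 ^ size (primes N) - 1) * (2 ^ r - 1))%:R :> algC.
    by rewrite natrM !natrB ?expn_gt0 // !natrX.
  rewrite -(ltr_pXn2r (ltn0Sn 1)) ?nnegrE ?ler0n ?sqrtC_ge0 ?ler0n //.
  by rewrite sqrtCK -natrX ltr_nat cardK.
apply: lt_le_trans (card_free_normal_lower _ _ _ (ltW a0) (ltW b0) (ltW c0) _ _ _) => //.
- by rewrite !mulr_gt0.
- exact: primes_uniq.
- by apply/allP=> l; rewrite mem_primes => /andP[].
- apply/allP=> l; rewrite mem_primes card_unit_factor => /and3P[_ _ lN].
  exact: dvdn_mulr.
Qed.

End Existence.

(** * Estimates for the exceptional cases *)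

Lemma le_nat_frac (R : numFieldType) (a b c d : nat) : (0 < b)%N -> (0 < d)%N ->
  (a%:R / b%:R <= c%:R / d%:R :> R) = (a * d <= c * b)%N.
Proof.
move=> b0 d0; rewrite ler_pdivrMr ?ltr0n // mulrAC ler_pdivlMr ?ltr0n //.
by rewrite -!natrM ler_nat.
Qed.

Lemma one_sub_inv (R : numFieldType) k : 1 - k.+1%:R^-1 = k%:R / k.+1%:R :> R.
Proof.
have k0 : k.+1%:R != 0 :> R by rewrite pnatr_eq0.
by apply: (mulIf k0); rewrite mulrBl mulVf // mul1r divfK // -natr1 addrK.
Qed.

Lemma natr_exp2_sub1 (R : numFieldType) k : 2%:R ^+ k - 1 = (2 ^ k - 1)%:R :> R.
Proof. by rewrite natrB ?expn_gt0 // natrX. Qed.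

(** The linear factor, if present, contributes 1/2, and each factor of higher degree at least
    3/4. *)
Lemma prod_mirr_lower (F : finFieldType) (s : seq {poly F}) k : all (@mirr F) s ->
    (count (fun f : {poly F} => size f == 2%N) s <= 1)%N -> (size s <= k.+1)%N ->
  1 / 2%:R * (3%:R / 4%:R) ^+ k <= \prod_(f <- s) (1 - (2 ^ (size f).-1)%:R^-1) :> algC.
Proof.
pose x : algC := 3%:R / 4%:R; pose y : algC := 1 / 2%:R; rewrite -/x -/y.
have x0 : 0 <= x by rewrite divr_ge0 ?ler0n.
have y0 : 0 <= y by rewrite divr_ge0 ?ler0n ?ler01.
have yx : y <= x by rewrite /x /y -[1]/(1%:R) le_nat_frac.
have x1 : x <= 1 by rewrite /x ler_pdivrMr ?ltr0n // mul1r ler_nat.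
move=> ms c1 sk.
pose c := count (fun f : {poly F} => size f == 2%N) s.
have cs : (c <= size s)%N by apply: count_size.
have : y ^+ c * x ^+ (size s - c) <= \prod_(f <- s) (1 - (2 ^ (size f).-1)%:R^-1).
  rewrite {c1 sk cs}/c; elim: s ms => [|f s IHs] /=; first by rewrite big_nil mulr1.
  move=> /andP[mf /IHs IH]; rewrite big_cons; have sf := mirr_size mf.
  have p0 : 0 <= y ^+ count (fun f : {poly F} => size f == 2%N) s *
      x ^+ (size s - count (fun f : {poly F} => size f == 2%N) s).
    by rewrite mulr_ge0 ?exprn_ge0.
  case: eqP => [->|/eqP sf2].
    rewrite add1n subSS exprS -mulrA; apply: ler_pM => //.
    by rewrite (one_sub_inv _ 1).
  rewrite add0n subSn ?count_size // exprS mulrCA; apply: ler_pM => //.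
  have xE : x = 1 - 4%:R^-1 by rewrite one_sub_inv.
  rewrite xE lerD2l lerN2 lef_pV2 ?posrE ?ltr0n ?expn_gt0 // ler_nat.
  rewrite -[4%N]/(2 ^ 2)%N leq_exp2l //.
  by rewrite -ltnS prednK ?(ltnW sf) // ltn_neqAle eq_sym sf2.
apply: le_trans; move: c1; rewrite -/c leq_eqVlt ltnS leqn0 => /orP[/eqP c1|/eqP c0].
  rewrite c1 expr1 ler_wpM2l // ler_wiXn2l //.
  by rewrite leq_subLR add1n.
rewrite c0 expr0 mul1r subn0; apply: (@le_trans _ _ (x ^+ k.+1)).
  by rewrite exprS ler_wpM2r ?exprn_ge0.
exact: ler_wiXn2l.
Qed.

Lemma sqrtC_exp2_ge0 i : 0 <= sqrtC (2%:R ^+ i) :> algC.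
Proof. by rewrite sqrtC_ge0 exprn_ge0 ?ler0n. Qed.

Lemma sqrtC_exp2_le i j : (i <= j * 2)%N -> sqrtC (2%:R ^+ i) <= 2%:R ^+ j :> algC.
Proof.
move=> ij; rewrite -(ler_pXn2r (ltn0Sn 1)) ?nnegrE ?sqrtC_exp2_ge0 ?exprn_ge0 ?ler0n //.
by rewrite sqrtCK -exprM ler_weXn2l // ler1n.
Qed.

(** [X] will be the irrational square root of 2^15. The subtracted term is below 2^5 * 2^8, a
    quarter of 2^15. *)
Lemma lower_2_15 (X : algC) : 0 <= X -> X <= 2%:R ^+ 8 ->
  3%:R * 2%:R ^+ 13 <= 2%:R ^+ 15 - (2%:R ^+ 1 - 1) * (2%:R ^+ 5 - 1) * X.
Proof.
move=> X0 X8.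
have -> : 3%:R * 2%:R ^+ 13 = 2%:R ^+ 15 - 2%:R ^+ 5 * 2%:R ^+ 8 :> algC.
  have -> : 2%:R ^+ 15 = 2%:R ^+ 2 * 2%:R ^+ 13 :> algC by rewrite -exprD.
  have -> : 2%:R ^+ 5 * 2%:R ^+ 8 = 1 * 2%:R ^+ 13 :> algC by rewrite mul1r -exprD.
  by rewrite -mulrBl natr_exp2_sub1.
rewrite lerD2l lerN2; apply: ler_pM => //; rewrite !natr_exp2_sub1 -natrM ?ler0n //.
by rewrite -natrX ler_nat.
Qed.

Section Exceptions.

Variables (F K : finFieldType) (iota : {rmorphism F -> K}).
Hypothesis F2 : #|F| = 2%N.

Section Setup.

Variable m : nat.
Hypotheses (m_gt1 : (1 < m)%N) (cardK : #|K| = (2 ^ m)%N).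

Lemma exception_sieve (S R : seq nat) (k : nat) (a b c : algC) (m' e : nat) :
    m = (m' * e)%N -> [pchar F].-nat e ->
    (forall r, 5 * r <= degree_bound 2 m m' -> r <= k.+1)%N ->
    uniq S -> all prime S -> all (dvdn^~ (2 ^ m).-1) (S ++ R) ->
    (forall l, prime l -> l %| (2 ^ m).-1 -> l \in S ++ R)%N ->
    0 <= a -> 0 <= b -> 0 <= c ->
    a <= \prod_(l <- S) (1 - l%:R^-1) ->
    b <= 1 / 2%:R * (3%:R / 4%:R) ^+ k ->
    c <= (2 ^ m)%:R - (2%:R ^+ size S - 1) * (2%:R ^+ k.+1 - 1) * sqrtC (2 ^ m)%:R ->
    (\sum_(l <- R) (2 ^ m).-1 %/ l)%:R < a * b * c ->
  exists2 x, x != 0 & full_free iota m x.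
Proof.
move=> mE eP rk uS pS dSR NSR a0 b0 c0 aS bk cX lt_abc.
have m_gt0 := ltnW m_gt1; have cardK' : #|K| = (#|F| ^ m)%N by rewrite F2.
have co : coprime m (#|F| - 1) by rewrite F2 coprimen1.
have [s [us ms ds cover]] := mirr_factors (@Xn_sub1_neq0 F m m_gt0).
have c1 := count_linear m_gt0 us ms ds co.
have sk : (size s <= k.+1)%N.
  by apply: rk; have := size_le5 m_gt0 us ms ds co mE eP; rewrite F2.
have KE : #|K|.-1 = (2 ^ m).-1 by rewrite cardK.
move: dSR; rewrite all_cat -KE => /andP[dS dR].
apply: (@full_free_sieve _ _ iota _ m_gt1 cardK' s ms cover S R) => //.
  move=> l; rewrite mem_primes => /and3P[pl _ lN]; apply: NSR => //.
  by rewrite predn_exp mul1n -F2.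
rewrite -(ltr_nat algC) KE; apply: lt_le_trans lt_abc _.
apply: (card_free_normal_lower iota m_gt1 cardK' us ms ds cover) => //.
  by apply: le_trans bk _; rewrite F2; apply: prod_mirr_lower.
apply: le_trans cX _; rewrite cardK lerD2l lerN2 ler_wpM2r ?sqrtC_ge0 ?ler0n //.
have pow_ge1 i : 0 <= 2%:R ^+ i - 1 :> algC by rewrite subr_ge0 exprn_ege1 // ler1n.
by rewrite ler_wpM2l // lerD2r ler_weXn2l // ler1n.
Qed.

End Setup.

Let F2nat : [pchar F].-nat 2.
Proof. by have := card_pnat_pchar (idfun : {rmorphism F -> F}); rewrite F2. Qed.

Lemma full_free_2_3 : #|K| = (2 ^ 3)%N -> exists2 x, x != 0 & full_free iota 3 x.
Proof.
move=> cardK.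
(* With no prime in the expansion the error term vanishes: 3/8 * 8 = 3 exceeds 7 / 7 = 1. *)
apply: (@exception_sieve 3 isT cardK [::] [:: 7]%N 1 1 (3%:R / 8%:R) 8%:R 3 1) => //.
- by move=> r; rewrite /degree_bound -[leqRHS]/10%N => h; rewrite -(leq_pmul2l (isT : 0 < 5)%N).
- move=> l pl; rewrite -[(2 ^ 3).-1]/7%N /= => l7.
  by rewrite inE -dvdn_prime2.
- by rewrite divr_ge0 ?ler0n.
- by rewrite big_nil.
- by rewrite expr1 mulf_div mul1r -natrM le_nat_frac.
- by rewrite expr0 subrr !mul0r subr0 ler_nat.
- by rewrite big_seq1 mul1r divfK ?pnatr_eq0 // ltr_nat.
Qed.

Lemma full_free_2_6 : #|K| = (2 ^ 6)%N -> exists2 x, x != 0 & full_free iota 6 x.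
Proof.
move=> cardK.
(* Here 40 = 64 - 1 * 3 * 8, and 2/3 * 3/8 * 40 = 10 exceeds 63 / 7 = 9. *)
apply: (@exception_sieve 6 isT cardK [:: 3]%N [:: 7]%N 1 (2%:R / 3%:R) (3%:R / 8%:R) 40%:R 3 2) => //.
- by move=> r; rewrite /degree_bound -[leqRHS]/10%N => h; rewrite -(leq_pmul2l (isT : 0 < 5)%N).
- move=> l pl; rewrite -[(2 ^ 6).-1]/(3 * (3 * 7))%N /= !Euclid_dvdM // !dvdn_prime2 //.
  by rewrite !inE => /or3P[]->; rewrite ?orbT.
- by rewrite divr_ge0 ?ler0n.
- by rewrite divr_ge0 ?ler0n.
- by rewrite big_seq1 one_sub_inv.
- by rewrite expr1 mulf_div mul1r -natrM le_nat_frac.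
- rewrite -[(2 ^ 6)%N]/(8 ^ 2)%N natrX sqrCK ?ler0n // -natrX !natr_exp2_sub1.
  by rewrite -!natrM -natrB // ler_nat.
- rewrite big_seq1 mulf_div -!natrM mulrAC -natrM ltr_pdivlMr ?ltr0n // -natrM.
  by rewrite ltr_nat.
Qed.

Lemma full_free_2_15 : #|K| = (2 ^ 15)%N -> exists2 x, x != 0 & full_free iota 15 x.
Proof.
move=> cardK; have nE : (2 ^ 15).-1 = (7 * (31 * 151))%N by lia.
(* The bounds 6/7 and 1/2 * (3/4)^4 are rounded down to 1/2 and 1/8; still 3 * 2^9 = 1536 exceeds 7
   * (151 + 31) = 1274. *)
apply: (@exception_sieve 15 isT cardK [:: 7]%N [:: 31; 151]%N 4 (1 / 2%:R) (1 / 8%:R)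
  (3%:R * 2%:R ^+ 13) 15 1).
- by [].
- by [].
- by move=> r; rewrite /degree_bound -[leqRHS]/25%N => h; rewrite -(leq_pmul2l (isT : 0 < 5)%N).
- by [].
- by [].
- apply/allP=> l; rewrite nE !inE => /or3P[]/eqP->.
  + exact: dvdn_mulr (dvdnn 7).
  + exact: dvdn_mull (dvdn_mulr _ (dvdnn 31)).
  + exact: dvdn_mull (dvdn_mull _ (dvdnn 151)).
- move=> l pl; rewrite nE !Euclid_dvdM // !dvdn_prime2 //.
  by rewrite !inE.
- by rewrite divr_ge0 ?ler0n ?ler01.
- by rewrite divr_ge0 ?ler0n ?ler01.
- by rewrite mulr_ge0 ?exprn_ge0 ?ler0n.
- by rewrite big_seq1 one_sub_inv -[X in X / _ <= _]/(1%:R) le_nat_frac.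
- by rewrite expr_div_n -!natrX mulf_div [X in _ <= X / _]mul1r -natrM -[X in X / _ <= _]/(1%:R) le_nat_frac.
- by rewrite natrX; apply: lower_2_15; [apply: sqrtC_exp2_ge0 | apply: sqrtC_exp2_le].
- rewrite big_cons big_seq1 nE.
  have -> : ((7 * (31 * 151)) %/ 31 + (7 * (31 * 151)) %/ 151 = 7 * 182)%N.
    by rewrite mulnCA mulKn // mulnCA mulnA mulnK // -mulnDr.
  have -> : 1 / 2%:R * (1 / 8%:R) * (3%:R * 2%:R ^+ 13) = (3 * 2 ^ 9)%:R :> algC.
    have -> : 2%:R ^+ 13 = (2 * 8)%:R * 2%:R ^+ 9 :> algC.
      by rewrite (exprD _ 4 9) -(natrX _ 2 4).
    by rewrite !mul1r -invfM -natrM [3%:R * _]mulrCA mulKf ?pnatr_eq0 // natrM natrX.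
  by rewrite ltr_nat.
Qed.

End Exceptions.

(** * The theorem *)

Lemma full_free_exists (F K : finFieldType) (iota : {rmorphism F -> K}) m :
    (0 < m)%N -> #|K| = (#|F| ^ m)%N -> coprime m (#|F| - 1) ->
  exists2 x, x != 0 & full_free iota m x.
Proof.
move=> m_gt0 cardK co; have q_gt1 : (1 < #|F|)%N by apply: finNzRing_gt1.
have [m1|m_le1|m1] := ltngtP m 1; first by move: m1; rewrite ltnNge m_gt0.
  have [ex|nex] := boolP (table_exception #|F| m).
    case/andP: ex => /eqP F2; rewrite F2 in cardK.
    rewrite !inE => /or3P[]/eqP mE; subst m.
    - exact: full_free_2_3.
    - exact: full_free_2_6.
    - exact: full_free_2_15.
  have [s [us ms ds cover]] := mirr_factors (@Xn_sub1_neq0 F m m_gt0).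
  apply: (full_free_generic iota m_le1 cardK us ms ds cover).
  apply: (sieve_numeric q_gt1 m_le1 co nex erefl _ erefl).
  - rewrite subn1 mulnC -predn_exp prednK ?expn_gt0 ?(ltnW q_gt1) //.
  - exact: size_le2 m_gt0 us ms ds co.
  (* In the range of the table [m] is below 70, so the sixth power of q captures the whole power of
     the characteristic dividing [m]. *)
  - pose e := gcdn m (#|F| ^ 6).
    apply: (size_le5 m_gt0 us ms ds co (m' := m %/ e) (e := e)).
      by rewrite divnK // dvdn_gcdl.
    apply: pnat_dvd (dvdn_gcdr _ _) _; rewrite pnatX orbF.
    exact: card_pnat_pchar (idfun : {rmorphism F -> F}).
exists 1; rewrite ?oner_neq0 //; split.
  rewrite m1 big_ord1 expn0 => l pl; rewrite dvdn1 => /eqP l1.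
  by rewrite l1 in pl.
move=> P P0; rewrite m1 => /size1_polyC PE.
by rewrite PE frobC mulr1 fmorph_eq0; apply: contraNneq P0 => c0; rewrite PE c0.
Qed.

(** Each power of q is 1 modulo q - 1, so the sum is congruent to [m]. *)
Lemma coprime_geometric q m : (0 < q)%N -> coprime m (q - 1) ->
  coprime (\sum_(i < m) q ^ i) (q - 1).
Proof.
move=> q_gt0; rewrite coprime_sym => co; rewrite coprime_sym /coprime.
rewrite -gcdn_modr; suff -> : (\sum_(i < m) q ^ i = m %[mod q - 1])%N by rewrite gcdn_modr.
elim: m {co} => [|m IHm]; first by rewrite big_ord0.
rewrite big_ord_recr /= -modnDm IHm.
have -> : (q ^ m = 1 %[mod q - 1])%N.
  by rewrite -{1}(subnK q_gt0) -modnXm modnDl modnXm exp1n.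
by rewrite modnDm addn1.
Qed.

(* The multiplicative group is the product of its subgroup of order [N] and of
   the group of nonzero scalars: [y] is the projection of [x] on the former. *)
Lemma free_scaling (F K : finFieldType) (iota : {rmorphism F -> K}) N (x : K) :
    #|K|.-1 = (N * (#|F| - 1))%N -> coprime N (#|F| - 1) -> x != 0 ->
    (forall l, prime l -> (l %| N)%N -> x ^+ (#|K|.-1 %/ l) != 1) ->
  exists c y, [/\ c != 0, y = iota c * x, y ^+ N = 1 &
    forall l, prime l -> (l %| N)%N -> y ^+ (N %/ l) != 1].
Proof.
move=> nE co x0 xfree; set q := #|F| in nE co.
have n_gt0 : (0 < #|K|.-1)%N by rewrite -subn1 subn_gt0 finNzRing_gt1.
have [N_gt0 q1_gt0] : (0 < N)%N /\ (0 < q - 1)%N.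
  by move: n_gt0; rewrite nE muln_gt0 => /andP[].
have xn : x ^+ (N * (q - 1)) = 1 by rewrite -nE expf_card_pred.
(* [e] is [1] modulo [N] and [0] modulo [q - 1]. *)
have [a b e_def _] := egcdnP N q1_gt0; rewrite gcdnC (eqP co) in e_def.
pose e := (a * (q - 1))%N; have eE : e = (b * N).+1 by rewrite /e e_def addn1.
have cF : exists c, x ^+ (b * N) = iota c.
  apply: iota_fixed; rewrite -/q -(subnK (_ : 1 <= q)%N); last first.
    by apply: ltnW; apply: finNzRing_gt1.
  by rewrite exprD expr1 -exprM -mulnA mulnC exprM xn expr1n mul1r.
have [c cE] := cF; exists c, (x ^+ e); split.
- by rewrite -(fmorph_eq0 iota) -cE expf_neq0.
- by rewrite -cE eE exprSr.
- by rewrite -exprM /e -mulnA mulnC [(_ * N)%N]mulnC exprM xn expr1n.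
move=> l pl lN; apply: contra (xfree l pl lN) => /eqP y1.
have nl : (#|K|.-1 %/ l = (q - 1) * (N %/ l))%N.
  by rewrite nE mulnC muln_divA.
(* The order of x^(n/l) divides [a] and [l], which are coprime because [e] is 1 modulo [N]. *)
have za : (x ^+ (#|K|.-1 %/ l)) ^+ a = 1.
  by rewrite -y1 -!exprM nl /e; congr (x ^+ _); rewrite mulnC mulnA.
have zl : (x ^+ (#|K|.-1 %/ l)) ^+ l = 1.
  by rewrite -exprM divnK ?nE // dvdn_mulr.
have al : coprime a l.
  apply: (coprime_dvdr lN).
  have : coprime e N by rewrite eE coprime_sym -addn1 /coprime gcdnMDl gcdn1.
  by rewrite /e coprimeMl => /andP[].
have [|u v uv _] := egcdnP l (_ : 0 < a)%N.
  by move: eE; rewrite /e; case: (a).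
have := congr1 (fun k => (x ^+ (#|K|.-1 %/ l)) ^+ k) uv.
rewrite (eqP al) exprD expr1 mulnC exprM za expr1n [(v * l)%N]mulnC exprM zl.
by rewrite expr1n mul1r => <-.
Qed.

Local Close Scope ring_scope.

Theorem theorem7 (p k q m : nat) (F : finFieldType) (L : fieldExtType F)
    (p_prime : prime p) (k_gt0 : 0 < k) (q_def : q = p ^ k) (m_gt0 : 0 < m)
    (cop_m_q1 : coprime m (q - 1))
    (cardF : #|F| = q) (dimL : \dim {:L}%VS = m) :
  exists u : {unit (finvect_type L)},
    normal_over (FinRing.uval u : L) /\ #[u]%g = (q ^ m - 1) %/ (q - 1).
Proof.
pose K := finvect_type L; pose iota : {rmorphism F -> K} := in_alg K.
have cardK : #|K| = #|F| ^ m.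
  by have := card_vspace (fullv : {vspace K}); rewrite card_vspacef => ->; rewrite -dimL.
rewrite -cardF in cop_m_q1 *.
have q_gt1 : 1 < #|F| by apply: finNzRing_gt1.
set N := (_ %/ _); have NE : N = \sum_(i < m) #|F| ^ i.
  by rewrite /N !subn1 predn_exp mulKn // -subn1 subn_gt0.
have [x x0 [xfree xnormal]] := full_free_exists iota m_gt0 cardK cop_m_q1.
have nE : #|K|.-1 = N * (#|F| - 1) by rewrite cardK predn_exp mulnC NE subn1.
have coN : coprime N (#|F| - 1) by rewrite NE coprime_geometric // ltnW.
rewrite -NE in xfree.
have [c [y [c0 yE yN yfree]]] := free_scaling iota nE coN x0 xfree.
have n_gt0 : 0 < #|K|.-1 by rewrite -subn1 subn_gt0 finNzRing_gt1.
have N_gt0 : 0 < N by move: n_gt0; rewrite nE muln_gt0 => /andP[].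
have yU : (y \is a GRing.unit)%R by rewrite unitfE yE mulf_neq0 ?fmorph_eq0.
pose u : {unit K} := FinRing.unit K yU.
have uX i : (u ^+ i == 1)%g = (y ^+ i == 1)%R.
  by rewrite -val_eqE /= FinRing.val_unitX.
exists u; split.
  have yq i : (y ^+ (#|F| ^ i) = iota c * x ^+ (#|F| ^ i))%R.
    by rewrite yE exprMn iota_qpow.
  rewrite /normal_over dimL.
  set s := [seq _ | _ <- _].
  have ss : size s == m by rewrite size_map size_iota.
  rewrite basisEfree subvf /= dimL size_map size_iota leqnn !andbT.
  have sE : s = tval (Tuple ss) by []; rewrite sE; apply/freeP => a a0.
  (* A linear relation between the conjugates of [y] is a polynomial of degree less than m that
     kills [y], hence also its scalar multiple [x]. *)
  pose P : {poly F} := (\poly_(j < m) oapp a 0 (insub j : option 'I_m))%R.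
  have Pi (i : 'I_m) : (P`_i = a i)%R by rewrite coef_poly ltn_ord valK.
  have [P0|/xnormal] := eqVneq P 0%R; first by move=> i; rewrite -Pi P0 coef0.
  rewrite size_poly => /(_ isT) /negP[]; apply/eqP.
  have frobP : frob iota #|F| P y = 0%R.
    rewrite (frobE iota #|F| y (size_poly m _)) -[RHS]a0.
    apply: eq_bigr => i _; rewrite Pi /= /s (nth_map 0) ?size_iota //.
    by rewrite nth_iota // add0n mulr_algl.
  have := frobZr iota 1 P c x; rewrite expn1 -yE frobP => /esym/eqP.
  by rewrite mulf_eq0 fmorph_eq0 (negPf c0) => /eqP.
have oN : #[u]%g %| N by rewrite order_dvdn uX yN.
rewrite -[RHS](divnK oN); set j := (_ %/ _).
have jN : N = j * #[u]%g by rewrite divnK.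
have j_gt0 : 0 < j by move: N_gt0; rewrite {1}jN muln_gt0 => /andP[].
suff -> : j = 1 by rewrite mul1n.
apply/eqP; rewrite eqn_leq j_gt0 andbT leqNgt; apply/negP=> j_gt1.
(* A prime divisor l of the index [j] would give y^(N/l) = 1. *)
have lj := pdiv_dvd j.
have := yfree (pdiv j) (pdiv_prime j_gt1); rewrite {1}jN dvdn_mulr // => /(_ isT).
by rewrite -uX -order_dvdn {1}jN -divn_mulAC // dvdn_mull.
Qed.
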